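(* Let $\mathbb{H}=\{\tau\in\mathbb{C}:\operatorname{Im}\tau>0\}$. Suppose that the complex coefficients $a_n$ ($n\in\mathbb{Z}$), $b_n$ ($n\in\mathbb{Z}\setminus\{0\}$) are subject to the subexponential growth bound $$\forall\epsilon>0:\quad|a_n|,|b_n|=O(e^{\epsilon|n|})\quad\text{as }|n|\to+\infty,$$ and that the associated harmonic hyperbolic Fourier series is trivial: $$a_0+\sum_{n>0}\big(a_n\,e^{i\pi n\tau}+b_n\,e^{-i\pi n/\tau}\big)+\sum_{n<0}\big(a_n\,e^{i\pi n\bar\tau}+b_n\,e^{-i\pi n/\bar\tau}\big)=0,\qquad\tau\in\mathbb{H}.$$ Suppose in addition that $$|a_n|=o\big(|n|^{-3/4}\exp(2\pi\sqrt{|n|})\big)\quad\text{as }|n|\to+\infty.$$ Then $a_0=0$ and $a_n=b_n=0$ for all $n\in\mathbb{Z}\setminus\{0\}$.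
   Context: Sums over $n>0$ and $n<0$ run over integers. Under the subexponential growth bound the series converges absolutely and uniformly on compact subsets of $\mathbb{H}$. *)

(* Defs.v *)
From Stdlib Require Import Reals ZArith.
From Coquelicot Require Import Coquelicot.
Open Scope R_scope.

Definition Cexp (z : C) : C := (exp (Re z) * cos (Im z), exp (Re z) * sin (Im z)).

(* The filter "|n| -> +oo" on Z. *)
Definition Z_infty (P : Z -> Prop) : Prop :=
  exists N : Z, forall n : Z, (N <= Z.abs n)%Z -> P n.

Definition subexponential (c : Z -> C) : Prop :=
  forall eps : R, 0 < eps ->
  exists M : R, Z_infty (fun n => Cmod (c n) <= M * exp (eps * Rabs (IZR n))).

(* With w = tau for n > 0 and w = Cconj tau for n < 0, these are the terms
   a_n e^(i pi n tau) + b_n e^(-i pi n / tau) and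
   a_n e^(i pi n taubar) + b_n e^(-i pi n / taubar). *)
Definition hfs_term (a b : Z -> C) (n : Z) (w : C) : C :=
  (a n * Cexp (Ci * PI * IZR n * w) + b n * Cexp (- (Ci * PI * IZR n) / w))%C.

(* The harmonic hyperbolic Fourier series with coefficients a, b converges at
   tau with sum s.  The sums over n > 0 and n < 0 are indexed by n = k+1 and
   n = -(k+1) for k : nat; the value b 0 is never used. *)
Definition is_harmonic_hfs (a b : Z -> C) (tau s : C) : Prop :=
  exists sp sm : C,
    is_series (V := C_NormedModule)
      (fun k : nat => hfs_term a b (Z.of_nat (S k)) tau) sp /\
    is_series (V := C_NormedModule)
      (fun k : nat => hfs_term a b (- Z.of_nat (S k)) (Cconj tau)) sm /\
    (a 0%Z + sp + sm)%C = s.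

(* Main.v *)
Require Import Defs.
From Stdlib Require Import Reals ZArith Lra Lia Classical ClassicalEpsilon.
From Coquelicot Require Import Coquelicot.
Open Scope R_scope.

(** The real and imaginary parts of the series give pairs [U = Re (sum A_m q^m)],
    [V = Re (sum B_m q^m)], with [q = exp (i pi tau)] and [B_0 = 0], related by
    [U(tau) = - V(-1/tau)].  Hence [U] is a harmonic function invariant under
    [tau + 2] and [tau / (1 - 2 tau)], bounded at the cusps [oo] and [0].
    Completing the square, the growth hypothesis gives [U = o(exp (pi / y))] as
    [y -> 0], that is, [k(z) = U(1 - 1/z) = o(exp (pi Im z))] at the third cusp.
    The odd part of [k] about any vertical line vanishes on the sides of a strip
    of width 1, where this growth rate is exactly what Phragmen-Lindelof
    excludes; so [k] has bounded oscillation on horizontal lines, and [k] or [-k]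
    is bounded above on a sequence of them.  Up to sign, [U] then attains its
    maximum on the upper half plane.  Comparison with an affine function of [y]
    shows that this maximum is at most the constant term [Re A_0], which forces
    all other coefficients to vanish; [B_0 = 0] finally kills [Re A_0] and [V]. *)

(** * Maximum principles *)

(** The two maps generate, modulo sign, the principal congruence group of level 2, which has three
    cusps: oo, 0 and 1. The two series bound [U] at the first two only, so the growth hypothesis has
    to serve at the third. There [k] has period 2, and a harmonic function of period 2 is made of
    modes of size [exp (+- pi n Im z)] and of an affine function of [Im z]. The hypothesis excludes
    the growing modes but not a term linear in [Im z]. Hence [k] may a priori be unbounded, only a
    one-sided bound is available, and its sign has to be chosen. The terms of negative index are
    antiholomorphic, so no holomorphic function on the quotient is at hand: everything rests on
    maximum principles for real parts. Nothing is lost by this, since the coefficients may first be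
    multiplied by [-i]. Only the weak maximum principle is proved; comparison with a strictly
    decreasing affine function then does the work of the strong one. *)

Lemma rectangle_max (f : R -> R -> R) (a b c d : R) :
  a <= b -> c <= d ->
  (forall x y, a <= x <= b -> c <= y <= d -> continuity_2d_pt f x y) ->
  exists p q, a <= p <= b /\ c <= q <= d /\
    forall x y, a <= x <= b -> c <= y <= d -> f x y <= f p q.
Proof.
intros Hab Hcd Hf.
assert (H1 : forall x, exists q, a <= x <= b ->
   c <= q <= d /\ forall y, c <= y <= d -> f x y <= f x q).
{ intros x. destruct (classic (a <= x <= b)) as [Hx | Hx].
  - destruct (continuity_ab_maj (f x) c d Hcd) as [q [Hq1 Hq2]].
    + intros y Hy. apply continuity_pt_filterlim. intros P HP.
      destruct HP as [e He].
      destruct (Hf x y Hx Hy e) as [r Hr].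
      exists r. intros z Hz. apply He. apply Hr.
      * replace (x - x) with 0 by ring. rewrite Rabs_R0. apply cond_pos.
      * exact Hz.
    + exists q. intros _. split; [exact Hq2 | exact Hq1].
  - exists 0. tauto. }
pose (g x := proj1_sig (constructive_indefinite_description _ (H1 x))).
assert (Hg : forall x, a <= x <= b ->
   c <= g x <= d /\ forall y, c <= y <= d -> f x y <= f x (g x)).
{ intros x. exact (proj2_sig (constructive_indefinite_description _ (H1 x))). }
(* the maximum over [y] is only known to be continuous in [x] within [[a, b]],
   so it is extended constantly by clamping *)
pose (clamp x := Rmax a (Rmin b x)).
assert (Hcl : forall x, a <= clamp x <= b).
{ intros x. unfold clamp, Rmax, Rmin. repeat destruct Rle_dec; lra. }
assert (Hcl2 : forall x, a <= x <= b -> clamp x = x).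
{ intros x Hx. unfold clamp, Rmax, Rmin. repeat destruct Rle_dec; lra. }
assert (Hcl3 : forall x x', Rabs (clamp x - clamp x') <= Rabs (x - x')).
{ intros x x'. unfold clamp, Rmax, Rmin, Rabs.
  repeat destruct Rle_dec; repeat destruct Rcase_abs; lra. }
destruct (continuity_ab_maj (fun x => f (clamp x) (g (clamp x))) a b Hab)
  as [p [Hp1 Hp2]].
{ intros x _. apply continuity_pt_filterlim. intros P [e He].
  destruct (uniform_continuity_2d f a b c d Hf e) as [r Hr].
  exists r. intros z Hz. apply He.
  destruct (Hg _ (Hcl x)) as [Gx1 Gx2]. destruct (Hg _ (Hcl z)) as [Gz1 Gz2].
  assert (Hzx : Rabs (clamp z - clamp x) < r).
  { eapply Rle_lt_trans; [apply Hcl3 | exact Hz]. }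
  assert (Z0 : forall y, Rabs (y - y) < r).
  { intros y. replace (y - y) with 0 by ring. rewrite Rabs_R0. apply cond_pos. }
  (* The maximizer [g] may jump, but the maxima do not: each is compared with the value at the other
     abscissa and the same ordinate. *)
  pose proof (Hr _ _ _ _ (Hcl x) Gx1 (Hcl z) Gx1 Hzx (Z0 _)) as A1.
  pose proof (Hr _ _ _ _ (Hcl x) Gz1 (Hcl z) Gz1 Hzx (Z0 _)) as A2.
  pose proof (Gx2 _ Gz1) as A3. pose proof (Gz2 _ Gx1) as A4.
  unfold ball; simpl; unfold AbsRing_ball, abs, minus, plus, opp; simpl.
  apply Rabs_def2 in A1. apply Rabs_def2 in A2.
  apply Rabs_def1; lra. }
exists p, (g p). split; [exact Hp2|]. split; [apply Hg, Hp2|].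
intros x y Hx Hy.
specialize (Hp1 x Hx). rewrite (Hcl2 x Hx), (Hcl2 p Hp2) in Hp1.
apply Rle_trans with (2 := Hp1). apply Hg; assumption.
Qed.

(* The four-point form of the Laplace equation needs no derivatives and still
   suffices for the weak maximum principle. *)
Definition harmonic_at (U : R -> R -> R) (x y : R) : Prop :=
  continuity_2d_pt U x y /\
  forall eps, 0 < eps -> exists delta, 0 < delta /\ forall t, 0 < t < delta ->
    Rabs (U (x + t) y + U (x - t) y + U x (y + t) + U x (y - t) - 4 * U x y)
    <= eps * t ^ 2.

Lemma harmonic_at_plus U V x y :
  harmonic_at U x y -> harmonic_at V x y ->
  harmonic_at (fun x y => U x y + V x y) x y.
Proof.
intros [CU HU] [CV HV]. split; [apply continuity_2d_pt_plus; assumption|].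
intros e He.
destruct (HU (e / 2)) as [d1 [Hd1 H1]]; [lra|].
destruct (HV (e / 2)) as [d2 [Hd2 H2]]; [lra|].
exists (Rmin d1 d2). split; [apply Rmin_glb_lt; assumption|].
intros t [Ht0 Ht]. pose proof (Rmin_l d1 d2). pose proof (Rmin_r d1 d2).
specialize (H1 t ltac:(lra)). specialize (H2 t ltac:(lra)).
apply Rabs_le_between in H1. apply Rabs_le_between in H2.
apply Rabs_le_between. lra.
Qed.

Lemma harmonic_at_scal k U x y :
  harmonic_at U x y -> harmonic_at (fun x y => k * U x y) x y.
Proof.
intros [CU HU]. split.
{ apply continuity_2d_pt_mult; [apply continuity_2d_pt_const | exact CU]. }
intros e He. pose proof (Rabs_pos k) as Hk.
destruct (HU (e / (Rabs k + 1))) as [d [Hd H]].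
{ apply Rdiv_lt_0_compat; lra. }
exists d. split; [exact Hd|]. intros t Ht. specialize (H t Ht).
replace (_ - _) with (k * (U (x + t) y + U (x - t) y + U x (y + t) + U x (y - t)
  - 4 * U x y)) by ring.
rewrite Rabs_mult.
apply Rle_trans with (Rabs k * (e / (Rabs k + 1) * t ^ 2)).
{ apply Rmult_le_compat_l; assumption. }
replace (Rabs k * _) with (e * t ^ 2 * (Rabs k / (Rabs k + 1))) by (field; lra).
rewrite <- (Rmult_1_r (e * t ^ 2)) at 2.
apply Rmult_le_compat_l; [nra|].
apply Rle_div_l; lra.
Qed.

Lemma harmonic_at_ext U V x y :
  (forall x y, U x y = V x y) -> harmonic_at U x y -> harmonic_at V x y.
Proof.
intros E [C H]. split; [eapply continuity_2d_pt_ext; eassumption|].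
intros e He. destruct (H e He) as [d [Hd H']]. exists d. split; [exact Hd|].
intros t Ht. rewrite <- !E. exact (H' t Ht).
Qed.

Lemma harmonic_at_minus U V x y :
  harmonic_at U x y -> harmonic_at V x y ->
  harmonic_at (fun x y => U x y - V x y) x y.
Proof.
intros HU HV.
apply harmonic_at_ext with (fun x y => U x y + (-1) * V x y); [intros; ring|].
apply harmonic_at_plus; [|apply harmonic_at_scal]; assumption.
Qed.

Lemma harmonic_at_affine a b x y : harmonic_at (fun _ y => a + b * y) x y.
Proof.
split.
{ apply continuity_2d_pt_plus; [apply continuity_2d_pt_const|].
  apply continuity_2d_pt_mult;
    [apply continuity_2d_pt_const | apply continuity_2d_pt_id2]. }
intros e He. exists 1. split; [lra|]. intros t Ht.
replace (_ - _) with 0 by ring. rewrite Rabs_R0. nra.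
Qed.

Lemma harmonic_at_quadratic c x y :
  harmonic_at (fun x y => (y - c) ^ 2 - x ^ 2 + 2 * x) x y.
Proof.
split.
{ apply continuity_2d_pt_ext with
    (fun x y => (y - c) * (y - c) + x * (2 - x)); [intros; ring|].
  apply continuity_2d_pt_plus; apply continuity_2d_pt_mult;
  try apply continuity_2d_pt_minus; auto using continuity_2d_pt_const,
    continuity_2d_pt_id1, continuity_2d_pt_id2. }
intros e He. exists 1. split; [lra|]. intros t Ht.
replace (_ - _) with 0 by ring. rewrite Rabs_R0. nra.
Qed.

Lemma harmonic_at_shift U s x y :
  harmonic_at U (s + x) y -> harmonic_at (fun x y => U (s + x) y) x y.
Proof.
intros [C H]. split.
{ intros e. destruct (C e) as [d Hd]. exists d. intros u v Hu Hv.
  apply Hd; [|exact Hv]. replace (s + u - (s + x)) with (u - x) by ring. exact Hu. }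
intros e He. destruct (H e He) as [d [Hd H']]. exists d. split; [exact Hd|].
intros t Ht. rewrite <- Rplus_assoc.
replace (s + (x - t)) with (s + x - t) by ring. exact (H' t Ht).
Qed.

Lemma harmonic_at_reflect U s x y :
  harmonic_at U (s - x) y -> harmonic_at (fun x y => U (s - x) y) x y.
Proof.
intros [C H]. split.
{ intros e. destruct (C e) as [d Hd]. exists d. intros u v Hu Hv.
  apply Hd; [|exact Hv]. replace (s - u - (s - x)) with (- (u - x)) by ring.
  rewrite Rabs_Ropp. exact Hu. }
intros e He. destruct (H e He) as [d [Hd H']]. exists d. split; [exact Hd|].
intros t Ht.
replace (s - (x - t)) with (s - x + t) by ring.
replace (s - (x + t)) with (s - x - t) by ring.
rewrite (Rplus_comm (U (s - x - t) y)). exact (H' t Ht).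
Qed.

(** Adding [e * y ^ 2] makes the four-point sum strictly positive, since it contributes
    [2 * e * t ^ 2] against an error of [e * t ^ 2]; this cannot happen at a maximum. Neighbours
    only need a copy in the rectangle at the same height, so that one proof covers both rectangles
    and periodic strips, whose vertical sides are not a boundary. *)
Lemma weak_max_principle (U : R -> R -> R) (a b c d : R) :
  a <= b -> c <= d ->
  (forall x y, a <= x <= b -> c <= y <= d -> continuity_2d_pt U x y) ->
  (forall x y, a <= x <= b -> c <= y <= d -> U x y <= 0 \/
     harmonic_at U x y /\ exists delta, 0 < delta /\ forall x' y',
       Rabs (x' - x) < delta -> Rabs (y' - y) < delta ->
       c <= y' <= d /\ exists x'', a <= x'' <= b /\ U x' y' = U x'' y') ->
  forall x y, a <= x <= b -> c <= y <= d -> U x y <= 0.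
Proof.
intros Hab Hcd Hc Hh x0 y0 Hx0 Hy0.
destruct (Rle_or_lt (U x0 y0) 0) as [Hle | Hpos]; [exact Hle|exfalso].
(* So small that the perturbation stays below [U x0 y0 / 2] on the rectangle; [U] is then still
   positive at the perturbed maximum. *)
set (e := U x0 y0 / (2 * (c ^ 2 + d ^ 2 + 1))).
assert (HQ : 0 < c ^ 2 + d ^ 2 + 1) by nra.
assert (He : 0 < e) by (unfold e; apply Rdiv_lt_0_compat; lra).
assert (HeQ : e * (c ^ 2 + d ^ 2 + 1) = U x0 y0 / 2) by (unfold e; field; lra).
destruct (rectangle_max (fun x y => U x y + e * y ^ 2) a b c d Hab Hcd)
  as [p [q [Hp [Hq Hmax]]]].
{ intros x y Hx Hy. apply continuity_2d_pt_plus; [apply Hc; assumption|].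
  apply continuity_2d_pt_ext with (fun x y => e * (y * y)); [intros; ring|].
  repeat apply continuity_2d_pt_mult;
    auto using continuity_2d_pt_const, continuity_2d_pt_id2. }
pose proof (Hmax x0 y0 Hx0 Hy0) as H0.
assert (Hqq : q ^ 2 <= c ^ 2 + d ^ 2 + 1).
{ destruct (Rle_or_lt 0 q); nra. }
destruct (Hh p q Hp Hq) as [Hn | [[_ HL] [r [Hr Hnear]]]]; [nra|].
destruct (HL e He) as [dl [Hdl HL']].
set (t := Rmin r dl / 2).
assert (Ht : 0 < t /\ t < r /\ t < dl).
{ unfold t. pose proof (Rmin_l r dl). pose proof (Rmin_r r dl).
  assert (0 < Rmin r dl) by (apply Rmin_glb_lt; assumption). lra. }
specialize (HL' t ltac:(lra)).
assert (N : forall x' y', Rabs (x' - p) < r -> Rabs (y' - q) < r ->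
  U x' y' + e * y' ^ 2 <= U p q + e * q ^ 2).
{ intros x' y' H1 H2. destruct (Hnear x' y' H1 H2) as [Hy' [x'' [Hx'' ->]]].
  apply Hmax; assumption. }
assert (A0 : forall z, Rabs (z - z) < r).
{ intros z. replace (z - z) with 0 by ring. rewrite Rabs_R0. exact Hr. }
assert (A1 : forall z, Rabs (z + t - z) < r).
{ intros z. replace (z + t - z) with t by ring. rewrite Rabs_pos_eq; lra. }
assert (A2 : forall z, Rabs (z - t - z) < r).
{ intros z. replace (z - t - z) with (- t) by ring.
  rewrite Rabs_Ropp, Rabs_pos_eq; lra. }
pose proof (N _ _ (A1 p) (A0 q)). pose proof (N _ _ (A2 p) (A0 q)).
pose proof (N _ _ (A0 p) (A1 q)). pose proof (N _ _ (A0 p) (A2 q)).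
apply Rabs_le_between in HL'.
assert (0 < e * t ^ 2) by (apply Rmult_lt_0_compat; nra).
assert (e * (q + t) ^ 2 + e * (q - t) ^ 2 = 2 * (e * q ^ 2) + 2 * (e * t ^ 2)) by ring.
lra.
Qed.

Lemma max_principle_rectangle (U : R -> R -> R) (a b c d : R) :
  a <= b -> c <= d ->
  (forall x y, a <= x <= b -> c <= y <= d -> harmonic_at U x y) ->
  (forall y, c <= y <= d -> U a y <= 0 /\ U b y <= 0) ->
  (forall x, a <= x <= b -> U x c <= 0 /\ U x d <= 0) ->
  forall x y, a <= x <= b -> c <= y <= d -> U x y <= 0.
Proof.
intros Hab Hcd HU Hv Hh. apply weak_max_principle; try assumption.
{ intros. now apply HU. }
intros x y Hx Hy.
destruct (Req_dec x a) as [-> | Na]; [left; now apply Hv|].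
destruct (Req_dec x b) as [-> | Nb]; [left; now apply Hv|].
destruct (Req_dec y c) as [-> | Nc]; [left; now apply Hh|].
destruct (Req_dec y d) as [-> | Nd]; [left; now apply Hh|].
right. split; [now apply HU|].
exists (Rmin (Rmin (x - a) (b - x)) (Rmin (y - c) (d - y))).
split; [repeat apply Rmin_glb_lt; lra|].
intros x' y' H1 H2.
pose proof (Rmin_l (Rmin (x - a) (b - x)) (Rmin (y - c) (d - y))).
pose proof (Rmin_r (Rmin (x - a) (b - x)) (Rmin (y - c) (d - y))).
pose proof (Rmin_l (x - a) (b - x)). pose proof (Rmin_r (x - a) (b - x)).
pose proof (Rmin_l (y - c) (d - y)). pose proof (Rmin_r (y - c) (d - y)).
apply Rabs_def2 in H1. apply Rabs_def2 in H2.
split; [lra|]. exists x'. split; [lra|reflexivity].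
Qed.

(** * Functions of period 2: strips and cusp neighbourhoods *)

Definition periodic2 (U : R -> R -> R) : Prop :=
  forall x y, 0 < y -> U (x + 2) y = U x y.

Lemma periodic2_IZR U (n : Z) x y : periodic2 U -> 0 < y -> U (x + 2 * IZR n) y = U x y.
Proof.
intros HU Hy.
assert (N : forall (m : nat) x, U (x + 2 * INR m) y = U x y).
{ induction m as [|m IH]; intros z.
  - simpl. f_equal. ring.
  - rewrite S_INR. replace (z + 2 * (INR m + 1)) with (z + 2 * INR m + 2) by ring.
    rewrite HU by exact Hy. apply IH. }
destruct (Z_le_gt_dec 0 n) as [Hn | Hn].
- rewrite <- (Z2Nat.id n Hn), <- INR_IZR_INZ. apply N.
- rewrite <- (N (Z.to_nat (- n)) (x + 2 * IZR n)).
  f_equal. rewrite INR_IZR_INZ, Z2Nat.id, opp_IZR by lia. ring.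
Qed.

Lemma reduce_mod2 (a x : R) : exists n : Z, a <= x + 2 * IZR n <= a + 2.
Proof.
exists (up ((a - x) / 2)). destruct (archimed ((a - x) / 2)) as [H1 H2]. lra.
Qed.

Lemma max_principle_strip (U : R -> R -> R) (c d : R) :
  0 < c <= d -> periodic2 U ->
  (forall x y, c <= y <= d -> harmonic_at U x y) ->
  (forall x, U x c <= 0 /\ U x d <= 0) ->
  forall x y, c <= y <= d -> U x y <= 0.
Proof.
intros Hcd HP HU Hb x y Hy.
destruct (reduce_mod2 (-1) x) as [n Hn].
rewrite <- (periodic2_IZR U n) by (assumption || lra).
apply (weak_max_principle U (-1) 1 c d); try lra.
{ intros. now apply HU. }
clear x y Hy n Hn. intros x y Hx Hy.
destruct (Req_dec y c) as [-> | Nc]; [left; now apply Hb|].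
destruct (Req_dec y d) as [-> | Nd]; [left; now apply Hb|].
right. split; [now apply HU|].
exists (Rmin (y - c) (d - y)). split; [repeat apply Rmin_glb_lt; lra|].
intros x' y' _ H2.
pose proof (Rmin_l (y - c) (d - y)). pose proof (Rmin_r (y - c) (d - y)).
apply Rabs_def2 in H2. split; [lra|].
destruct (reduce_mod2 (-1) x') as [n Hn]. exists (x' + 2 * IZR n).
split; [lra|]. symmetry. apply periodic2_IZR; [assumption | lra].
Qed.

(** Phragmen-Lindelof at a cusp. The affine majorant rises from [M] at [v0] to [M + K] at [v1], and
    its slope tends to 0 as [v1] grows; bounds on a sequence of heights [v1] are therefore
    enough. *)
Lemma cusp_max_principle (U : R -> R -> R) (v0 M : R) :
  0 < v0 -> periodic2 U ->
  (forall x y, v0 <= y -> harmonic_at U x y) ->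
  (forall x, U x v0 <= M) ->
  (exists L, forall N, exists v, N <= v /\ forall x, U x v <= L) ->
  forall x y, v0 <= y -> U x y <= M.
Proof.
intros Hv0 HP HU HM [L HL] x y Hy.
set (K := Rmax 0 (L - M)).
assert (HK : 0 <= K /\ L - M <= K) by (unfold K; split; [apply Rmax_l | apply Rmax_r]).
apply Rle_plus_epsilon. intros e He.
destruct (HL (Rmax (y + 1) (v0 + K * (y - v0) / e))) as [v1 [Hv1 H1]].
pose proof (Rmax_l (y + 1) (v0 + K * (y - v0) / e)).
pose proof (Rmax_r (y + 1) (v0 + K * (y - v0) / e)).
assert (B : U x y - (M + K / (v1 - v0) * (y - v0)) <= 0).
{ apply (max_principle_strip
    (fun x y => U x y - (M + K / (v1 - v0) * (y - v0))) v0 v1); try lra.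
  - intros x' y' Hy'. now rewrite HP.
  - intros x' y' Hy'. apply harmonic_at_minus; [apply HU; lra|].
    apply harmonic_at_ext with
      (fun _ y => (M - K / (v1 - v0) * v0) + K / (v1 - v0) * y); [intros; ring|].
    apply harmonic_at_affine.
  - intros x'. specialize (HM x'). specialize (H1 x').
    replace (M + K / (v1 - v0) * (v0 - v0)) with M by (field; lra).
    replace (M + K / (v1 - v0) * (v1 - v0)) with (M + K) by (field; lra). lra. }
assert (K / (v1 - v0) * (y - v0) <= e).
{ replace (K / (v1 - v0) * (y - v0)) with (K * (y - v0) / (v1 - v0)) by (field; lra).
  apply Rle_div_l; [lra|].
  assert (K * (y - v0) / e <= v1 - v0) as E by lra.
  apply Rle_div_l in E; lra. }
lra.
Qed.

(** * Complex expansions *)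

Lemma exp_le_compat (x y : R) : x <= y -> exp x <= exp y.
Proof. intros [H | ->]; [left; now apply exp_increasing | right; reflexivity]. Qed.

Lemma Cexp_plus z w : Cexp (z + w) = (Cexp z * Cexp w)%C.
Proof.
destruct z as [a b], w as [c d]. unfold Cexp, Cmult, Cplus; simpl.
rewrite exp_plus, cos_plus, sin_plus. f_equal; ring.
Qed.

Lemma Cmod_Cexp z : Cmod (Cexp z) = exp (Re z).
Proof.
destruct z as [a b]. unfold Cexp, Cmod; simpl.
replace (_ + _) with (exp a * exp a * ((sin b)² + (cos b)²)) by (unfold Rsqr; ring).
rewrite sin2_cos2, Rmult_1_r. apply sqrt_square. left. apply exp_pos.
Qed.

Lemma Re_Cexp_line_derive (c w : C) (s : R) :
  is_derive (fun s : R => Re (c * Cexp (s * w))) s (Re (c * w * Cexp (s * w))).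
Proof.
destruct c as [p q], w as [a b]. unfold Cexp, Cmult; simpl.
auto_derive; [tauto|].
replace (s * a - 0 * b) with (s * a) by ring.
replace (s * b + 0 * a) with (s * b) by ring.
replace (s * a + - (0 * b)) with (s * a) by ring. ring.
Qed.

Lemma bounded_derivative (f df : R -> R) (K : R) :
  f 0 = 0 -> (forall s, 0 <= s <= 1 -> is_derive f s (df s)) ->
  (forall s, 0 <= s <= 1 -> Rabs (df s) <= K) ->
  forall s, 0 <= s <= 1 -> Rabs (f s) <= K.
Proof.
intros F0 D B s Hs.
destruct (MVT_gen f 0 s df) as [x [Hx E]].
- intros x. rewrite Rmin_left, Rmax_right by lra. intros. apply D; lra.
- intros x. rewrite Rmin_left, Rmax_right by lra. intros.
  apply derivable_continuous_pt. exists (df x). apply is_derive_Reals, D; lra.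
- rewrite Rmin_left, Rmax_right in Hx by lra.
  replace (f s) with (df x * (s - 0)) by lra.
  rewrite Rabs_mult, (Rabs_pos_eq (s - 0)) by lra.
  specialize (B x ltac:(lra)). pose proof (Rabs_pos (df x)). nra.
Qed.

Lemma Rabs_Re_mult_le (c w : C) : Rabs (Re (c * w)) <= Cmod c * Cmod w.
Proof. rewrite <- Cmod_mult. apply re_le_Cmod. Qed.

(** The third derivative along the segment from 0 to [w] is bounded by the right-hand side, and
    three uses of the mean value theorem bring the bound down to the function. The factor 1/6 is
    given up. *)
Lemma Re_Cexp_taylor (c w : C) :
  Rabs (Re (c * Cexp w) - Re c - Re (c * w) - Re (c * w * w) / 2)
  <= Cmod c * Cmod w ^ 3 * exp (Cmod w).
Proof.
set (K := Cmod c * Cmod w ^ 3 * exp (Cmod w)).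
assert (Z : forall c, Re (c * Cexp (0%R * w)) = Re c).
{ intros [p q]. destruct w as [a b]. unfold Cexp, Cmult; simpl.
  replace (0 * a - 0 * b) with 0 by ring. replace (0 * b + 0 * a) with 0 by ring.
  rewrite exp_0, cos_0, sin_0. ring. }
assert (H3 : forall s, 0 <= s <= 1 -> Rabs (Re (c * w * w * w * Cexp (s * w))) <= K).
{ intros s Hs. eapply Rle_trans; [apply Rabs_Re_mult_le|].
  rewrite !Cmod_mult, Cmod_Cexp. unfold K.
  replace (Cmod c * Cmod w ^ 3) with (Cmod c * Cmod w * Cmod w * Cmod w) by ring.
  pose proof (Cmod_ge_0 c). pose proof (Cmod_ge_0 w).
  apply Rmult_le_compat_l; [repeat apply Rmult_le_pos; assumption|].
  assert (Re (s * w) <= Cmod w) as [L | ->].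
  { rewrite re_scal_l. pose proof (re_le_Cmod w). apply Rabs_le_between in H1. nra. }
  - left. now apply exp_increasing.
  - right; reflexivity. }
assert (H2 : forall s, 0 <= s <= 1 ->
  Rabs (Re (c * w * w * Cexp (s * w)) - Re (c * w * w)) <= K).
{ apply bounded_derivative with (3 := H3).
  - rewrite Z. ring.
  - intros s _.
    replace (Re (c * w * w * w * Cexp (s * w)))
      with (Re (c * w * w * w * Cexp (s * w)) - 0) by ring.
    apply (is_derive_minus (V := R_NormedModule)); [apply Re_Cexp_line_derive|].
    apply (is_derive_const (V := R_NormedModule)). }
assert (H1 : forall s, 0 <= s <= 1 ->
  Rabs (Re (c * w * Cexp (s * w)) - (Re (c * w) + s * Re (c * w * w))) <= K).
{ apply bounded_derivative with (3 := H2).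
  - rewrite Z. ring.
  - intros s _.
    apply (is_derive_minus (V := R_NormedModule)); [apply Re_Cexp_line_derive|].
    generalize (Re (c * w)) (Re (c * w * w)). intros. auto_derive; [exact I | ring]. }
assert (H0 : forall s, 0 <= s <= 1 ->
  Rabs (Re (c * Cexp (s * w)) - (Re c + s * Re (c * w) + s ^ 2 / 2 * Re (c * w * w)))
  <= K).
{ apply bounded_derivative with (3 := H1).
  - rewrite Z. field.
  - intros s _.
    apply (is_derive_minus (V := R_NormedModule)); [apply Re_Cexp_line_derive|].
    generalize (Re c) (Re (c * w)) (Re (c * w * w)). intros.
    auto_derive; [exact I | simpl; field]. }
specialize (H0 1 ltac:(lra)). rewrite Cmult_1_l in H0.
replace (_ - _ - _ - _) with
  (Re (c * Cexp w) - (Re c + 1 * Re (c * w) + 1 ^ 2 / 2 * Re (c * w * w))) by field.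
exact H0.
Qed.

(* Stands in for "real part of a holomorphic function": it is stable under
   composition with [s - 1/z] and implies [harmonic_at]. *)
Definition peano2 (U : C -> R) (z : C) : Prop :=
  exists g1 g2 : C, forall eps, 0 < eps -> exists delta, 0 < delta /\
    forall h : C, Cmod h < delta ->
      Rabs (U (z + h)%C - U z - Re (g1 * h + g2 * h * h)) <= eps * Cmod h ^ 2.

Lemma Cmod_real_dir (t : R) : Cmod (t, 0) = Rabs t.
Proof. apply (Cmod_R t). Qed.

Lemma Cmod_imag_dir (t : R) : Cmod (0, t) = Rabs t.
Proof.
replace (0, t) with (Ci * t)%C by (unfold Ci, Cmult; simpl; f_equal; ring).
rewrite Cmod_mult, Cmod_Ci, Cmod_R. ring.
Qed.

(** On the stencil [t, -t, it, -it] the linear terms cancel in pairs, and the quadratic ones cancel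
    because [(it)^2 = - t^2]. Four errors of [e / 4] remain. *)
Lemma peano2_harmonic_at (U : C -> R) (x y : R) :
  peano2 U (x, y) -> harmonic_at (fun x y => U (x, y)) x y.
Proof.
intros [g1 [g2 H]]. split.
- intros e. destruct (H 1 Rlt_0_1) as [d [Hd H']].
  set (L := Cmod g1 + Cmod g2 + 1).
  assert (HL : 0 < L).
  { unfold L. pose proof (Cmod_ge_0 g1). pose proof (Cmod_ge_0 g2). lra. }
  set (r := Rmin (Rmin d 1) (e / L)).
  assert (Hr : 0 < r).
  { unfold r. repeat apply Rmin_glb_lt; try lra.
    apply Rdiv_lt_0_compat; [apply cond_pos | exact HL]. }
  assert (Hr2 : 0 < r / 2) by lra.
  exists (mkposreal _ Hr2). simpl. intros u v Hu Hv.
  set (h := ((u - x, v - y) : C)).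
  assert (Hh : Cmod h < r).
  { eapply Rle_lt_trans; [apply Cmod_2Rmax|]. unfold h; simpl.
    assert (sqrt 2 < 2).
    { rewrite <- (sqrt_square 2) at 2 by lra. apply sqrt_lt_1; lra. }
    assert (Rmax (Rabs (u - x)) (Rabs (v - y)) < r / 2) by (apply Rmax_lub_lt; assumption).
    assert (0 <= Rmax (Rabs (u - x)) (Rabs (v - y))).
    { eapply Rle_trans; [apply Rabs_pos | apply Rmax_l]. }
    pose proof (sqrt_pos 2). nra. }
  pose proof (Rmin_l (Rmin d 1) (e / L)) as E1. pose proof (Rmin_r (Rmin d 1) (e / L)) as E2.
  pose proof (Rmin_l d 1). pose proof (Rmin_r d 1). fold r in E1, E2.
  specialize (H' h ltac:(lra)).
  replace ((x, y) + h)%C with ((u, v) : C) in H'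
    by (unfold h, Cplus; simpl; f_equal; ring).
  assert (B : Rabs (Re (g1 * h + g2 * h * h)) <= Cmod g1 * Cmod h + Cmod g2 * Cmod h * Cmod h).
  { eapply Rle_trans; [apply re_le_Cmod|].
    eapply Rle_trans; [apply Cmod_triangle|]. rewrite !Cmod_mult. lra. }
  pose proof (Cmod_ge_0 h). pose proof (Cmod_ge_0 g2). pose proof (Cmod_ge_0 g1).
  assert (Cmod h * L < e).
  { apply Rlt_div_r; [exact HL | lra]. }
  assert (Cmod h * Cmod h <= Cmod h) by nra.
  apply Rabs_le_between in B. apply Rabs_le_between in H'.
  unfold L in *. apply Rabs_def1; nra.
- intros e He. destruct (H (e / 4)) as [d [Hd H']]; [lra|].
  exists d. split; [exact Hd|]. intros t Ht.
  assert (T : Rabs t = t) by (apply Rabs_pos_eq; lra).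
  pose proof (H' (t, 0) ltac:(rewrite Cmod_real_dir; lra)) as A1.
  pose proof (H' (- t, 0) ltac:(rewrite Cmod_real_dir, Rabs_Ropp; lra)) as A2.
  pose proof (H' (0, t) ltac:(rewrite Cmod_imag_dir; lra)) as A3.
  pose proof (H' (0, - t) ltac:(rewrite Cmod_imag_dir, Rabs_Ropp; lra)) as A4.
  assert (T' : Rabs (- t) = t) by (rewrite Rabs_Ropp; exact T).
  rewrite Cmod_real_dir, T in A1. rewrite Cmod_real_dir, T' in A2.
  rewrite Cmod_imag_dir, T in A3. rewrite Cmod_imag_dir, T' in A4.
  clear H'. destruct g1 as [p1 q1], g2 as [p2 q2].
  unfold Cplus, Cmult in A1, A2, A3, A4; simpl in A1, A2, A3, A4.
  rewrite ?Rplus_0_r, ?Rmult_1_r in A1, A2, A3, A4.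
  apply Rabs_le_between in A1. apply Rabs_le_between in A2.
  apply Rabs_le_between in A3. apply Rabs_le_between in A4.
  apply Rabs_le_between. unfold Rminus in *. simpl. nra.
Qed.

Lemma peano2_Cexp (A k z : C) : peano2 (fun z => Re (A * Cexp (k * z))) z.
Proof.
set (c := (A * Cexp (k * z))%C).
exists (c * k)%C, (c * k * k / 2)%C. intros e He.
set (L := Cmod c * Cmod k ^ 3 * exp (Cmod k) + 1).
assert (HL : 0 < L).
{ unfold L. assert (0 <= Cmod c * Cmod k ^ 3 * exp (Cmod k)); [|lra].
  apply Rmult_le_pos; [apply Rmult_le_pos | left; apply exp_pos];
    auto using pow_le, Cmod_ge_0. }
exists (Rmin 1 (e / L)). split.
{ apply Rmin_glb_lt; [lra | now apply Rdiv_lt_0_compat]. }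
intros h Hh. pose proof (Rmin_l 1 (e / L)). pose proof (Rmin_r 1 (e / L)).
pose proof (Cmod_ge_0 h). pose proof (Cmod_ge_0 k). pose proof (Cmod_ge_0 c).
replace (Re (A * Cexp (k * (z + h)))) with (Re (c * Cexp (k * h))).
2: { unfold c. rewrite <- Cmult_assoc, <- Cexp_plus. do 3 f_equal; ring. }
replace (Re (c * k * h + c * k * k / 2 * h * h)) with
  (Re (c * (k * h)) + Re (c * (k * h) * (k * h)) / 2).
2: { replace (c * k * h + c * k * k / 2 * h * h)%C
       with (c * (k * h) + (/ 2)%R * (c * (k * h) * (k * h)))%C.
     - rewrite re_plus, re_scal_l. field.
     - rewrite RtoC_inv by lra. field. }
cbv beta. fold c.
replace (_ - _ - _) with (Re (c * Cexp (k * h)) - Re c - Re (c * (k * h))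
  - Re (c * (k * h) * (k * h)) / 2) by ring.
eapply Rle_trans; [apply Re_Cexp_taylor|]. rewrite Cmod_mult.
assert (E : exp (Cmod k * Cmod h) <= exp (Cmod k)).
{ destruct (Rle_lt_or_eq_dec (Cmod k * Cmod h) (Cmod k)) as [E | ->]; [nra| |lra].
  left; now apply exp_increasing. }
assert (Cmod h * L <= e).
{ apply Rle_div_r; [exact HL | lra]. }
apply Rle_trans with (Cmod h ^ 2 * (Cmod h * (Cmod c * Cmod k ^ 3 * exp (Cmod k)))).
- replace (Cmod c * (Cmod k * Cmod h) ^ 3 * exp (Cmod k * Cmod h)) with
    (Cmod h ^ 2 * (Cmod h * (Cmod c * Cmod k ^ 3 * exp (Cmod k * Cmod h)))) by ring.
  repeat (apply Rmult_le_compat_l; [auto using pow_le, Rmult_le_pos|]).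
  exact E.
- rewrite (Rmult_comm e). apply Rmult_le_compat_l; [now apply pow_le|].
  unfold L in *. nra.
Qed.

(** The exact increment of [- / z] is [h' = h / (z (z + h))]. Substituted into the expansion of [U],
    it yields the chain rule coefficients and a remainder [h^3 Q] with [Q] bounded for
    [Cmod h < r / 2]. *)
Lemma peano2_comp_inv (U : C -> R) (s z : C) :
  z <> RtoC 0 -> peano2 U (s - / z)%C -> peano2 (fun z => U (s - / z)%C) z.
Proof.
intros Hz [g1 [g2 H]].
set (r := Cmod z). assert (Hr : 0 < r) by now apply Cmod_gt_0.
exists (g1 / (z * z))%C, (- (g1 / (z * z * z)) + g2 / (z * z * z * z))%C.
intros e He.
(* Since [Cmod h' <= 2 * Cmod h / r ^ 2], this precision becomes [e / 2 * Cmod h ^ 2]; the other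
   half of [e] is left for the cubic remainder. *)
destruct (H (e * r ^ 4 / 8)) as [d [Hd H']].
{ assert (0 < r ^ 4) by now apply pow_lt. nra. }
set (K := 2 * Cmod g1 / r ^ 4 + 12 * Cmod g2 / r ^ 5).
pose proof (Cmod_ge_0 g1) as G1. pose proof (Cmod_ge_0 g2) as G2.
assert (HK : 0 <= K).
{ unfold K. assert (0 < r ^ 4 /\ 0 < r ^ 5) as [] by (split; now apply pow_lt).
  apply Rplus_le_le_0_compat; apply Rdiv_le_0_compat; lra. }
exists (Rmin (r / 2) (Rmin (d * r ^ 2 / 2) (e / (2 * (K + 1))))).
split.
{ repeat apply Rmin_glb_lt; try lra.
  - assert (0 < r ^ 2) by now apply pow_lt. nra.
  - apply Rdiv_lt_0_compat; lra. }
intros h Hh.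
pose proof (Rmin_l (r / 2) (Rmin (d * r ^ 2 / 2) (e / (2 * (K + 1))))).
pose proof (Rmin_r (r / 2) (Rmin (d * r ^ 2 / 2) (e / (2 * (K + 1))))).
pose proof (Rmin_l (d * r ^ 2 / 2) (e / (2 * (K + 1)))).
pose proof (Rmin_r (d * r ^ 2 / 2) (e / (2 * (K + 1)))).
assert (h1 : Cmod h < r / 2) by lra.
assert (h2 : Cmod h < d * r ^ 2 / 2) by lra.
assert (h3 : Cmod h < e / (2 * (K + 1))) by lra.
pose proof (Cmod_ge_0 h) as h0.
assert (Hzh : r / 2 <= Cmod (z + h)).
{ pose proof (Cmod_triangle (z + h) (- h)) as T. rewrite Cmod_opp in T.
  replace (z + h + - h)%C with z in T by ring. fold r in T. lra. }
assert (Nzh : (z + h <> 0)%C) by (apply Cmod_gt_0; lra).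
assert (H2zh : Cmod (2 * z + h) <= 3 * r).
{ eapply Rle_trans; [apply Cmod_triangle|]. rewrite Cmod_mult, Cmod_R, Rabs_pos_eq by lra.
  fold r. lra. }
set (h' := (h / (z * (z + h)))%C).
assert (Hh' : Cmod h' <= 2 * Cmod h / r ^ 2).
{ unfold h'. rewrite Cmod_div by now apply Cmult_neq_0. rewrite Cmod_mult. fold r.
  replace (2 * Cmod h / r ^ 2) with (Cmod h / (r * (r / 2))) by (field; lra).
  apply Rmult_le_compat_l; [exact h0|]. apply Rinv_le_contravar; nra. }
specialize (H' h').
replace (s - / z + h')%C with (s - / (z + h))%C in H'
  by (unfold h'; field; split; assumption).
assert (Hd' : Cmod h' < d).
{ apply Rle_lt_trans with (1 := Hh'). apply Rlt_div_l; [now apply pow_lt | lra]. }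
specialize (H' Hd').
set (Q := (g1 / (z * z * z * (z + h)) - g2 * (2 * z + h) / (z * z * z * z * ((z + h) * (z + h))))%C).
assert (E : (g1 * h' + g2 * h' * h' = g1 / (z * z) * h +
   (- (g1 / (z * z * z)) + g2 / (z * z * z * z)) * h * h + h * h * h * Q)%C).
{ unfold h', Q. field. split; assumption. }
assert (HQ : Cmod Q <= K).
{ unfold Q, K. eapply Rle_trans; [apply Cmod_triangle|]. rewrite Cmod_opp.
  rewrite !Cmod_div by (repeat apply Cmult_neq_0; assumption).
  rewrite !Cmod_mult. fold r. apply Rplus_le_compat.
  - replace (2 * Cmod g1 / r ^ 4) with (Cmod g1 / (r * r * r * (r / 2))) by (field; lra).
    apply Rmult_le_compat_l; [exact G1|].
    assert (0 < r * r * r) by (repeat apply Rmult_lt_0_compat; exact Hr).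
    apply Rinv_le_contravar; nra.
  - replace (12 * Cmod g2 / r ^ 5) with
      (Cmod g2 * (3 * r) / (r * r * r * r * (r / 2 * (r / 2)))) by (field; lra).
    assert (0 < r * r * r * r) by (repeat apply Rmult_lt_0_compat; exact Hr).
    apply Rmult_le_compat.
    + apply Rmult_le_pos; [exact G2 | apply Cmod_ge_0].
    + left; apply Rinv_0_lt_compat. apply Rmult_lt_0_compat; nra.
    + apply Rmult_le_compat_l; assumption.
    + apply Rinv_le_contravar; [apply Rmult_lt_0_compat; nra|].
      apply Rmult_le_compat_l; [lra|]. apply Rmult_le_compat; lra. }
rewrite E, re_plus in H'.
assert (B : Rabs (Re (h * h * h * Q)) <= e / 2 * Cmod h ^ 2).
{ eapply Rle_trans; [apply re_le_Cmod|]. rewrite !Cmod_mult.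
  apply Rle_trans with (Cmod h ^ 2 * (Cmod h * (K + 1))).
  - replace (Cmod h * Cmod h * Cmod h * Cmod Q) with (Cmod h ^ 2 * (Cmod h * Cmod Q)) by ring.
    apply Rmult_le_compat_l; [now apply pow_le|]. apply Rmult_le_compat_l; lra.
  - rewrite Rmult_comm. apply Rmult_le_compat_r; [now apply pow_le|].
    assert (Cmod h * (2 * (K + 1)) < e) by (apply Rlt_div_r; lra). lra. }
assert (B2 : e * r ^ 4 / 8 * Cmod h' ^ 2 <= e / 2 * Cmod h ^ 2).
{ replace (e / 2 * Cmod h ^ 2) with (e * r ^ 4 / 8 * (2 * Cmod h / r ^ 2) ^ 2)
    by (field; lra).
  apply Rmult_le_compat_l.
  - assert (0 < r ^ 4) by now apply pow_lt. nra.
  - apply pow_incr. split; [apply Cmod_ge_0 | exact Hh']. }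
apply Rabs_le_between in B. apply Rabs_le_between in H'. apply Rabs_le_between. lra.
Qed.

(** * One-sided series in powers of [q] and their termwise expansion *)

Lemma is_series_Re (a : nat -> C) (s : C) :
  is_series (V := C_NormedModule) a s -> is_series (fun n => Re (a n)) (Re s).
Proof.
intros H P [e He].
assert (S : forall n, sum_n (fun n => Re (a n)) n = Re (sum_n (G := C_NormedModule) a n)).
{ induction n as [|n IH]; [now rewrite !sum_O|]. rewrite !sum_Sn, IH. reflexivity. }
destruct (H (fun z => P (Re z))) as [N HN].
{ exists e. intros z [Hz _]. now apply He. }
exists N. intros n Hn. rewrite S. now apply HN.
Qed.

Lemma Series_nonneg (a : nat -> R) :
  (forall n, 0 <= a n) -> ex_series a -> 0 <= Series a.
Proof.
intros Ha Hex. rewrite <- (Rmult_0_l (Series a)), <- Series_scal_l.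
apply Series_le; [|exact Hex]. intros n. specialize (Ha n). lra.
Qed.

(** That is, the power series with coefficients [A] has radius of convergence at least 1. *)
Definition abs_summable (A : nat -> C) : Prop :=
  forall c, 0 < c -> ex_series (fun m => Cmod (A m) * exp (- (c * INR m))).

Lemma cubic_le_exp (c : R) : 0 < c ->
  exists K, 0 <= K /\ forall m, (1 + INR m) ^ 3 * exp (- (c * INR m)) <= K.
Proof.
(* With this [k], [k * (1 + m) <= 1 + c / 3 * m <= exp (c / 3 * m)], and it remains to take
   cubes. *)
intros Hc. set (k := Rmin 1 (c / 3)).
assert (Hk : 0 < k) by (apply Rmin_glb_lt; lra).
exists (/ k ^ 3). split; [left; apply Rinv_0_lt_compat; now apply pow_lt|].
intros m. pose proof (pos_INR m) as Hm.
assert (H1 : k * (1 + INR m) <= exp (c / 3 * INR m)).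
{ eapply Rle_trans; [|apply exp_ineq1_le].
  pose proof (Rmin_l 1 (c / 3)). pose proof (Rmin_r 1 (c / 3)). fold k in H, H0. nra. }
assert (H3 : k ^ 3 * (1 + INR m) ^ 3 <= exp (c * INR m)).
{ rewrite <- Rpow_mult_distr.
  replace (exp (c * INR m)) with (exp (c / 3 * INR m) ^ 3).
  - apply pow_incr. split; [|exact H1]. apply Rmult_le_pos; lra.
  - simpl. rewrite Rmult_1_r, <- !exp_plus. f_equal. field. }
assert (Hk3 : 0 < k ^ 3) by now apply pow_lt.
rewrite exp_Ropp. apply Rmult_le_reg_l with (k ^ 3); [exact Hk3|].
rewrite Rinv_r by lra. rewrite <- Rmult_assoc.
apply Rle_div_l; [apply exp_pos | lra].
Qed.

(** The cubic weight pays for the factor [m ^ 3] in the third-order Taylor remainder of the [m]-th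
    term. *)
Lemma abs_summable_cubic A c : abs_summable A -> 0 < c ->
  ex_series (fun m => Cmod (A m) * (1 + INR m) ^ 3 * exp (- (c * INR m))).
Proof.
intros HA Hc. destruct (cubic_le_exp (c / 2)) as [K [HK0 HK]]; [lra|].
apply (ex_series_le (V := R_CompleteNormedModule)) with
  (fun m => K * (Cmod (A m) * exp (- (c / 2 * INR m)))).
- intros m. pose proof (Cmod_ge_0 (A m)). pose proof (pos_INR m).
  match goal with |- norm ?x <= _ => change (norm x) with (Rabs x) end.
  rewrite Rabs_pos_eq.
  + replace (- (c * INR m)) with (- (c / 2 * INR m) + - (c / 2 * INR m)) by field.
    rewrite exp_plus.
    replace (_ * _ * _) with ((Cmod (A m) * exp (- (c / 2 * INR m))) *
      ((1 + INR m) ^ 3 * exp (- (c / 2 * INR m)))) by ring.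
    rewrite (Rmult_comm K). apply Rmult_le_compat_l; [|apply HK].
    apply Rmult_le_pos; [assumption | left; apply exp_pos].
  + apply Rmult_le_pos; [apply Rmult_le_pos; [assumption | apply pow_le; lra]
      | left; apply exp_pos].
- apply (ex_series_scal_l (K := R_AbsRing) (V := R_NormedModule)). apply HA. lra.
Qed.

Definition qexp (m : nat) (z : C) : C := Cexp (Ci * PI * INR m * z).

Lemma Cmod_qexp m z : Cmod (qexp m z) = exp (- (PI * Im z * INR m)).
Proof.
unfold qexp. rewrite Cmod_Cexp. f_equal. destruct z as [x y]. simpl. ring.
Qed.

Definition re_qseries (A : nat -> C) (z : C) : R := Series (fun m => Re (A m * qexp m z)).

Lemma Rabs_qterm_le A m z :
  Rabs (Re (A m * qexp m z)) <= Cmod (A m) * exp (- (PI * Im z * INR m)).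
Proof. rewrite <- Cmod_qexp. apply Rabs_Re_mult_le. Qed.

Lemma ex_series_qterm_abs A z : abs_summable A -> 0 < Im z ->
  ex_series (fun m => Rabs (Re (A m * qexp m z))).
Proof.
intros HA Hz.
apply (ex_series_le (V := R_CompleteNormedModule)) with
  (fun m => Cmod (A m) * exp (- (PI * Im z * INR m))).
- intros m. match goal with |- norm ?x <= _ => change (norm x) with (Rabs x) end. rewrite Rabs_Rabsolu.
  apply Rabs_qterm_le.
- apply HA. apply Rmult_lt_0_compat; [apply PI_RGT_0 | exact Hz].
Qed.

Lemma ex_series_qterm A z : abs_summable A -> 0 < Im z ->
  ex_series (fun m => Re (A m * qexp m z)).
Proof. intros. now apply ex_series_Rabs, ex_series_qterm_abs. Qed.

Lemma re_qseries_bound A z : abs_summable A -> 0 < Im z ->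
  Rabs (re_qseries A z) <= Series (fun m => Cmod (A m) * exp (- (PI * Im z * INR m))).
Proof.
intros HA Hz. eapply Rle_trans; [apply Series_Rabs, ex_series_qterm_abs; assumption|].
apply Series_le.
- intros m. split; [apply Rabs_pos | apply Rabs_qterm_le].
- apply HA. apply Rmult_lt_0_compat; [apply PI_RGT_0 | exact Hz].
Qed.

Lemma peano2_re_qseries A z : abs_summable A -> 0 < Im z -> peano2 (re_qseries A) z.
Proof.
intros HA Hz. pose proof PI_RGT_0 as HPI.
assert (Hc : 0 < PI * Im z / 2) by nra.
(* The modulus of [qexp m z] is [exp (- 2 c m)]. One factor [exp (- c m)] absorbs
   [exp (PI * m * Cmod h)] for [Cmod h <= Im z / 2], the other ensures convergence. *)
set (c := PI * Im z / 2) in *.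
set (ip := (Ci * PI)%C).
assert (Hip : Cmod ip = PI).
{ unfold ip. rewrite Cmod_mult, Cmod_Ci, Cmod_R, Rabs_pos_eq; lra. }
set (t m := (A m * qexp m z)%C).
assert (Ht : forall m, Cmod (t m) = Cmod (A m) * exp (- (2 * c * INR m))).
{ intros m. unfold t. rewrite Cmod_mult, Cmod_qexp. do 3 f_equal. unfold c. field. }
pose proof (abs_summable_cubic A c HA Hc) as HS.
set (b m := Cmod (A m) * (1 + INR m) ^ 3 * exp (- (c * INR m))) in HS.
assert (Hexp : forall m, exp (- (2 * c * INR m)) <= exp (- (c * INR m))).
{ intros m. pose proof (pos_INR m).
  destruct (Req_dec (INR m) 0) as [-> | N]; [right; f_equal; ring|].
  left; apply exp_increasing. nra. }
assert (Hb : forall m k, 0 <= k <= (1 + INR m) ^ 3 -> k * Cmod (t m) <= b m).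
{ intros m k Hk. rewrite Ht. unfold b.
  replace (k * _) with (Cmod (A m) * k * exp (- (2 * c * INR m))) by ring.
  pose proof (Cmod_ge_0 (A m)).
  apply Rmult_le_compat; [apply Rmult_le_pos; lra | left; apply exp_pos | | apply Hexp].
  apply Rmult_le_compat_l; lra. }
(* [g1] is the termwise complex derivative of the series, and [g2] below is half the second one. *)
destruct (ex_series_le (V := C_CompleteNormedModule)
  (fun m => t m * (INR m * ip))%C (fun m => PI * b m)) as [g1 Hg1].
{ intros m. pose proof (pos_INR m). match goal with |- norm ?x <= ?y => change (Cmod x <= y) end.
  rewrite !Cmod_mult, Hip, Cmod_R.
  rewrite Rabs_pos_eq by assumption.
  replace (_ * _) with (PI * (INR m * Cmod (t m))) by ring.
  apply Rmult_le_compat_l; [lra|]. apply Hb. nra. }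
{ apply (ex_series_scal_l (K := R_AbsRing) (V := R_NormedModule)). exact HS. }
destruct (ex_series_le (V := C_CompleteNormedModule)
  (fun m => t m * (INR m * ip) * (INR m * ip) * / 2%R)%C (fun m => PI ^ 2 * b m))
  as [g2 Hg2].
{ intros m. pose proof (pos_INR m). rewrite <- RtoC_inv by lra.
  match goal with |- norm ?x <= ?y => change (Cmod x <= y) end.
  rewrite !Cmod_mult, Hip, !Cmod_R.
  rewrite (Rabs_pos_eq (INR m)) by assumption. rewrite Rabs_pos_eq by lra.
  replace (_ * _) with (PI ^ 2 * (INR m ^ 2 / 2 * Cmod (t m))) by field.
  apply Rmult_le_compat_l; [nra|]. apply Hb. nra. }
{ apply (ex_series_scal_l (K := R_AbsRing) (V := R_NormedModule)). exact HS. }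
set (S := Series (fun m => PI ^ 3 * b m)).
assert (HS3 : ex_series (fun m => PI ^ 3 * b m)).
{ apply (ex_series_scal_l (K := R_AbsRing) (V := R_NormedModule)). exact HS. }
assert (Hb0 : forall m, 0 <= b m).
{ intros m. pose proof (Hb m 0). pose proof (pos_INR m). nra. }
assert (HPI3 : 0 < PI ^ 3) by now apply pow_lt.
assert (HS0 : 0 <= S).
{ apply Series_nonneg; [|exact HS3]. intros m.
  apply Rmult_le_pos; [lra | apply Hb0]. }
exists g1, g2. intros e He. exists (Rmin (Im z / 2) (e / (S + 1))).
split.
{ apply Rmin_glb_lt; [lra|]. apply Rdiv_lt_0_compat; lra. }
intros h Hh. pose proof (Rmin_l (Im z / 2) (e / (S + 1))).
pose proof (Rmin_r (Im z / 2) (e / (S + 1))). pose proof (Cmod_ge_0 h) as Hh0.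
assert (Hzh : 0 < Im (z + h)).
{ destruct z as [x y], h as [u v]. simpl in *.
  pose proof (Rmax_Cmod (u, v)) as M. simpl in M.
  pose proof (Rmax_r (Rabs u) (Rabs v)). assert (L : Rabs v < y / 2) by lra.
  apply Rabs_def2 in L. lra. }
set (w m := (INR m * ip * h)%C).
assert (T1 : forall m, Re (A m * qexp m (z + h)) = Re (t m * Cexp (w m))).
{ intros m. unfold t, w, qexp, ip.
  replace (Ci * PI * INR m * (z + h))%C
    with (Ci * PI * INR m * z + INR m * (Ci * PI) * h)%C by ring.
  rewrite Cexp_plus, Cmult_assoc. reflexivity. }
assert (T2 : is_series (fun m => Re (t m * w m + t m * w m * w m * / 2%R))
  (Re (g1 * h + g2 * h * h))).
{ apply is_series_Re.
  apply is_series_ext with (fun m => plus (scal h (t m * (INR m * ip))%C)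
    (scal (h * h)%C (t m * (INR m * ip) * (INR m * ip) * / 2%R)%C)).
  - intros m. unfold plus, scal, w; simpl; unfold mult; simpl.
    change Cplus with (@plus C_AbelianMonoid). unfold plus; simpl. ring.
  - replace (g1 * h + g2 * h * h)%C with (plus (scal h g1) (scal (h * h)%C g2)).
    + apply (is_series_plus (V := C_NormedModule));
        apply (is_series_scal (V := C_NormedModule)); assumption.
    + unfold plus, scal; simpl; unfold mult; simpl. ring. }
assert (D : is_series (fun m => Re (t m * Cexp (w m)) - Re (t m)
   - Re (t m * w m + t m * w m * w m * / 2%R))
  (re_qseries A (z + h) - re_qseries A z - Re (g1 * h + g2 * h * h))).
{ apply (is_series_minus (V := R_NormedModule)); [apply (is_series_minus (V := R_NormedModule))|exact T2].
  - apply is_series_ext with (fun m => Re (A m * qexp m (z + h)));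
      [exact T1 | now apply Series_correct, ex_series_qterm].
  - now apply Series_correct, ex_series_qterm. }
assert (B : forall m, Rabs (Re (t m * Cexp (w m)) - Re (t m)
   - Re (t m * w m + t m * w m * w m * / 2%R)) <= Cmod h ^ 3 * (PI ^ 3 * b m)).
{ intros m. pose proof (pos_INR m) as Hm.
  rewrite re_plus, <- RtoC_inv, re_scal_r by lra.
  replace (Re (t m * Cexp (w m)) - Re (t m) - _) with
    (Re (t m * Cexp (w m)) - Re (t m) - Re (t m * w m) - Re (t m * w m * w m) / 2) by field.
  eapply Rle_trans; [apply Re_Cexp_taylor|].
  assert (Hw : Cmod (w m) = PI * INR m * Cmod h).
  { unfold w. rewrite !Cmod_mult, Hip, Cmod_R, Rabs_pos_eq by assumption. ring. }
  rewrite Hw, Ht.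
  assert (E : exp (- (2 * c * INR m)) * exp (PI * INR m * Cmod h) <= exp (- (c * INR m))).
  { rewrite <- exp_plus.
    assert (L : - (2 * c * INR m) + PI * INR m * Cmod h <= - (c * INR m)).
    { assert (PI * Cmod h <= c) by (unfold c; nra). nra. }
    destruct L as [L | ->]; [left; now apply exp_increasing | lra]. }
  unfold b.
  replace (Cmod (A m) * _ * _ * _) with ((Cmod h ^ 3 * PI ^ 3 * Cmod (A m)) *
    (INR m ^ 3 * (exp (- (2 * c * INR m)) * exp (PI * INR m * Cmod h)))) by ring.
  replace (Cmod h ^ 3 * (PI ^ 3 * _)) with ((Cmod h ^ 3 * PI ^ 3 * Cmod (A m)) *
    ((1 + INR m) ^ 3 * exp (- (c * INR m)))) by ring.
  apply Rmult_le_compat_l.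
  { apply Rmult_le_pos; [apply Rmult_le_pos; [now apply pow_le | lra] | apply Cmod_ge_0]. }
  apply Rmult_le_compat; [now apply pow_le | | apply pow_incr; lra | exact E].
  rewrite <- exp_plus. left; apply exp_pos. }
rewrite <- (is_series_unique _ _ D).
assert (DA : ex_series (fun m => Rabs (Re (t m * Cexp (w m)) - Re (t m)
   - Re (t m * w m + t m * w m * w m * / 2%R)))).
{ apply (ex_series_le (V := R_CompleteNormedModule)) with (fun m => Cmod h ^ 3 * (PI ^ 3 * b m)).
  - intros m. match goal with |- norm ?x <= _ => change (norm x) with (Rabs x) end. rewrite Rabs_Rabsolu. apply B.
  - apply (ex_series_scal_l (K := R_AbsRing) (V := R_NormedModule)). exact HS3. }
eapply Rle_trans; [apply Series_Rabs; exact DA|].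
eapply Rle_trans; [apply Series_le with (b := fun m => Cmod h ^ 3 * (PI ^ 3 * b m))|].
{ intros m. split; [apply Rabs_pos | apply B]. }
{ apply (ex_series_scal_l (K := R_AbsRing) (V := R_NormedModule)). exact HS3. }
rewrite Series_scal_l. fold S.
assert (Cmod h * (S + 1) <= e) by (apply Rle_div_r; lra).
replace (Cmod h ^ 3 * S) with (Cmod h * S * Cmod h ^ 2) by ring.
apply Rmult_le_compat_r; [now apply pow_le | lra].
Qed.

(** * Growth of the series near the real line *)

Lemma Rpower_m34 (x : R) : 0 < x -> Rpower x (- (3 / 4)) = / (sqrt x * sqrt (sqrt x)).
Proof.
intros Hx. rewrite <- !Rpower_sqrt; try apply exp_pos; try exact Hx.
rewrite Rpower_mult, <- Rpower_plus, Rpower_Ropp. do 2 f_equal. field.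
Qed.

(* Completing the square:
   [2 pi sqrt m - pi m / X = pi X - pi (sqrt m - X)^2 / X],
   so the sum over [m] is a Gaussian sum in [sqrt m]; [saddle_primitive] is a
   primitive, in the discrete sense, of a Lorentzian majorant. *)
Definition saddle_primitive (X : R) (m : nat) : R :=
  12 * atan ((sqrt (INR m) - X) / sqrt X) - 2 / (INR m + 1).

Definition saddle_term (X : R) (m : nat) : R :=
  Rpower (INR m) (- (3 / 4)) * exp (2 * PI * sqrt (INR m) - PI * INR m / X).

(** The intermediate point [c] is within 1 of [v], so [1 + c^2 <= 3 + 2 v^2 <= 3 (1 + v^2)]. *)
Lemma atan_increment (u v : R) : u < v -> v - u <= 1 ->
  (v - u) / (3 * (1 + v ^ 2)) <= atan v - atan u.
Proof.
intros H1 H2.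
destruct (MVT_cor2 atan (fun x => / (1 + x ^ 2)) u v H1) as [c [-> Hc]].
{ intros c _. apply derivable_pt_lim_atan. }
unfold Rdiv. rewrite Rmult_comm. apply Rmult_le_compat_r; [lra|].
assert ((v - c) ^ 2 <= 1) by nra. pose proof (pow2_ge_0 (2 * v - c)).
apply Rinv_le_contravar; nra.
Qed.

Lemma saddle_term_le (X : R) (m : nat) : 1 <= X ->
  saddle_term X (S m) <=
  exp (PI * X) * (saddle_primitive X (S m) - saddle_primitive X m).
Proof.
intros HX. pose proof PI_RGT_0 as HPI. pose proof PI2_1 as HPI2.
assert (Hm0 := pos_INR m). set (n := INR m) in *.
assert (Hn1 : INR (S m) = n + 1) by apply S_INR.
unfold saddle_term, saddle_primitive. rewrite Hn1. fold n.
set (s := sqrt (n + 1)). set (r := sqrt n). set (q := sqrt X).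
assert (Hs2 : s * s = n + 1) by (apply sqrt_sqrt; lra).
assert (Hr2 : r * r = n) by (apply sqrt_sqrt; lra).
assert (Hq2 : q * q = X) by (apply sqrt_sqrt; lra).
assert (Hr0 : 0 <= r) by apply sqrt_pos.
assert (Hs1 : 1 <= s) by (rewrite <- sqrt_1; apply sqrt_le_1; lra).
assert (Hq1 : 1 <= q) by (rewrite <- sqrt_1; apply sqrt_le_1; lra).
assert (Hrs : r < s) by nra.
assert (Hsr1 : s - r <= 1) by nra.
assert (Hsr2 : / (2 * s) <= s - r).
{ apply Rmult_le_reg_l with (2 * s); [lra|]. rewrite Rinv_r by lra. nra. }
set (u := (s - X) / q).
assert (Hu : u * q = s - X) by (unfold u; field; lra).
replace (2 * PI * s - PI * (n + 1) / X) with (PI * X + - (PI * u ^ 2)).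
2: { unfold u. rewrite <- Hs2, <- Hq2. field. lra. }
rewrite exp_plus. set (E := exp (PI * X)). assert (HE : 0 < E) by apply exp_pos.
rewrite Rpower_m34 by lra. fold s.
replace (/ (s * sqrt s) * (E * exp (- (PI * u ^ 2)))) with
  (E * (/ (s * sqrt s) * exp (- (PI * u ^ 2)))) by ring.
apply Rmult_le_compat_l; [lra|].
set (v := (r - X) / q).
assert (Huv : u - v = (s - r) / q) by (unfold u, v; field; lra).
assert (Hq' : 0 < / q <= 1).
{ split; [apply Rinv_0_lt_compat; lra|]. rewrite <- Rinv_1. apply Rinv_le_contravar; lra. }
assert (Huv0 : v < u) by (assert (0 < (s - r) / q) by (apply Rdiv_lt_0_compat; lra); lra).
assert (Huv1 : u - v <= 1) by (rewrite Huv; unfold Rdiv; nra).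
pose proof (atan_increment v u Huv0 Huv1) as HT.
assert (Hw : 0 < 2 / (n + 1) - 2 / (n + 1 + 1)).
{ replace (_ - _) with (2 / ((n + 1) * (n + 1 + 1))) by (field; lra).
  apply Rdiv_lt_0_compat; nra. }
assert (Hss : 1 <= sqrt s) by (rewrite <- sqrt_1; apply sqrt_le_1; lra).
assert (Hss2 : sqrt s * sqrt s = s) by (apply sqrt_sqrt; lra).
(* For [s >= X / 4] the Gaussian is below the Lorentzian [/ (1 + u ^ 2)], which the arctangent sums.
   For [s < X / 4] the saddle is so far away that the Gaussian is at most [exp (- X)], hence at most
   [/ (n + 1) ^ 2], which the telescoping rational part sums. *)
destruct (Rle_or_lt (X / 4) s) as [Hc | Hc].
- apply Rle_trans with (12 * (atan u - atan v)); [|lra].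
  apply Rle_trans with (12 * ((u - v) / (3 * (1 + u ^ 2)))); [|lra].
  rewrite Huv.
  assert (Hg : exp (- (PI * u ^ 2)) <= / (1 + u ^ 2)).
  { rewrite exp_Ropp. apply Rinv_le_contravar; [nra|].
    eapply Rle_trans; [|apply exp_ineq1_le]. nra. }
  assert (Hqs : q <= 2 * sqrt s) by nra.
  apply Rle_trans with (/ (s * (q / 2)) * / (1 + u ^ 2)).
  + apply Rmult_le_compat; [left; apply Rinv_0_lt_compat; nra | left; apply exp_pos | | exact Hg].
    apply Rinv_le_contravar; nra.
  (* The weight 12 is the product of 3 from [atan_increment], 2 from [/ (2 * s) <= s - r] and 2 from
     [q <= 2 * sqrt s]. *)
  + replace (12 * ((s - r) / q / (3 * (1 + u ^ 2)))) with
      (4 * (s - r) * (/ q * / (1 + u ^ 2))) by (field; split; nra).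
    replace (/ (s * (q / 2)) * / (1 + u ^ 2)) with
      (4 * / (2 * s) * (/ q * / (1 + u ^ 2))) by (field; repeat split; nra).
    apply Rmult_le_compat_r; [|lra].
    apply Rmult_le_pos; left; apply Rinv_0_lt_compat; nra.
- apply Rle_trans with (2 / (n + 1) - 2 / (n + 1 + 1)).
  2: { assert (0 < (u - v) / (3 * (1 + u ^ 2))) by (apply Rdiv_lt_0_compat; nra). lra. }
  apply Rle_trans with (exp (- X)).
  + rewrite <- (Rmult_1_l (exp (- X))). apply Rmult_le_compat.
    * left; apply Rinv_0_lt_compat; nra.
    * left; apply exp_pos.
    * rewrite <- Rinv_1. apply Rinv_le_contravar; nra.
    * assert (Hux : 9 / 16 * X <= u ^ 2).
      { unfold u. replace (((s - X) / q) ^ 2) with ((X - s) ^ 2 / X)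
          by (rewrite <- Hq2; field; lra).
        apply -> Rle_div_r; [|lra]. replace (9 / 16 * X * X) with ((3 / 4 * X) ^ 2) by field.
        apply pow_incr; lra. }
      left; apply exp_increasing. nra.
  + replace (_ - _) with (/ ((n + 1) * (n + 1 + 1) / 2)) by (field; lra).
    rewrite exp_Ropp. apply Rinv_le_contravar; [nra|].
    assert (HX4 : (X / 4) ^ 4 <= exp X).
    { replace (exp X) with (exp (X / 4) ^ 4).
      - apply pow_incr. split; [lra|]. pose proof (exp_ineq1_le (X / 4)). lra.
      - simpl. rewrite Rmult_1_r, <- !exp_plus. f_equal. field. }
    apply Rle_trans with (2 := HX4).
    assert (n + 1 <= (X / 4) ^ 2) by nra.
    replace ((X / 4) ^ 4) with ((X / 4) ^ 2 * (X / 4) ^ 2) by ring. nra.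
Qed.

Lemma saddle_primitive_incr (X : R) (m : nat) : 1 <= X ->
  saddle_primitive X m <= saddle_primitive X (S m).
Proof.
intros HX. pose proof (saddle_term_le X m HX) as H.
assert (0 < saddle_term X (S m)).
{ unfold saddle_term. apply Rmult_lt_0_compat; apply exp_pos. }
pose proof (exp_pos (PI * X)). nra.
Qed.

(** The total variation is at most [12 * PI + 2], and [PI <= 4]. What matters is uniformity in
    [X]. *)
Lemma saddle_primitive_range (X : R) (m k : nat) :
  saddle_primitive X m - saddle_primitive X k <= 50.
Proof.
unfold saddle_primitive. pose proof PI_4.
pose proof (atan_bound ((sqrt (INR m) - X) / sqrt X)).
pose proof (atan_bound ((sqrt (INR k) - X) / sqrt X)).
pose proof (pos_INR m). pose proof (pos_INR k).
assert (0 < 2 / (INR m + 1)) by (apply Rdiv_lt_0_compat; lra).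
assert (2 / (INR k + 1) <= 2) by (apply Rle_div_l; lra).
lra.
Qed.

Lemma Series_le_bound (a : nat -> R) (B : R) :
  ex_series a -> (forall n, sum_n a n <= B) -> Series a <= B.
Proof.
intros Ha HB.
apply (is_lim_seq_le (sum_n a) (fun _ => B) (Series a) B HB).
- exact (Series_correct a Ha).
- apply is_lim_seq_const.
Qed.

(** The finitely many terms with large coefficient quotient give [K], uniformly in [z]. The others
    are at most [eps / 50] times saddle terms at [X = / Im z], whose sum telescopes to at most
    [50 * exp (PI * X)]. *)
Lemma re_qseries_growth (A : nat -> C) : abs_summable A ->
  (forall eps, 0 < eps -> exists N, forall m, (N <= m)%nat ->
     Cmod (A m) <= eps * (Rpower (INR m) (- (3 / 4)) * exp (2 * PI * sqrt (INR m)))) ->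
  forall eps, 0 < eps -> exists K, forall z, 0 < Im z <= 1 ->
    Rabs (re_qseries A z) <= K + eps * exp (PI / Im z).
Proof.
intros HA HG eps Heps. pose proof PI_RGT_0 as HPI.
destruct (HG (eps / 50)) as [N HN]; [lra|].
exists (sum_n (fun m => Cmod (A m)) N). intros z Hz.
set (X := / Im z).
assert (HX : 1 <= X) by (unfold X; rewrite <- Rinv_1; apply Rinv_le_contravar; lra).
eapply Rle_trans; [apply re_qseries_bound; [exact HA | lra]|].
apply Series_le_bound.
{ apply HA. apply Rmult_lt_0_compat; lra. }
set (t m := Cmod (A m) * exp (- (PI * Im z * INR m))).
assert (Ht0 : forall m, t m <= Cmod (A m)).
{ intros m. unfold t. rewrite <- (Rmult_1_r (Cmod (A m))) at 2.
  apply Rmult_le_compat_l; [apply Cmod_ge_0|]. rewrite <- exp_0.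
  pose proof (pos_INR m).
  assert (0 <= PI * Im z * INR m) as [L | <-] by (apply Rmult_le_pos; [apply Rmult_le_pos|]; lra).
  - left; apply exp_increasing; lra.
  - right; f_equal; ring. }
assert (Hmono : forall n, saddle_primitive X 0 <= saddle_primitive X n).
{ induction n as [|n IH]; [lra|]. pose proof (saddle_primitive_incr X n HX). lra. }
pose proof (exp_pos (PI * X)) as HE.
assert (Hsmall : forall n, (n <= N)%nat -> sum_n t n <= sum_n (fun m => Cmod (A m)) N).
{ intros n Hn. apply Rle_trans with (sum_n (fun m => Cmod (A m)) n).
  - apply sum_n_m_le. exact Ht0.
  - clear HN. induction Hn as [|N' Hn IH]; [lra|]. rewrite sum_Sn.
    change (plus ?x ?y) with (x + y). pose proof (Cmod_ge_0 (A (S N'))).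
    lra. }
assert (HF : forall n, sum_n t n <= sum_n (fun m => Cmod (A m)) N +
   eps / 50 * (exp (PI * X) * (saddle_primitive X n - saddle_primitive X 0))).
{ assert (Hc : forall n, 0 <= eps / 50 * (exp (PI * X) * (saddle_primitive X n - saddle_primitive X 0))).
  { intros n. specialize (Hmono n). apply Rmult_le_pos; [lra|]. apply Rmult_le_pos; lra. }
  induction n as [|n IH].
  { specialize (Hsmall 0%nat ltac:(lia)). specialize (Hc 0%nat). lra. }
  destruct (le_lt_dec (S n) N) as [Hn | Hn].
  { specialize (Hsmall (S n) Hn). specialize (Hc (S n)). lra. }
  rewrite sum_Sn. change (plus ?x ?y) with (x + y).
  assert (t (S n) <= eps / 50 * (exp (PI * X) *
    (saddle_primitive X (S n) - saddle_primitive X n))); [|lra].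
  apply Rle_trans with (eps / 50 * saddle_term X (S n)).
  - unfold t, saddle_term. replace (2 * PI * sqrt (INR (S n)) - PI * INR (S n) / X)
      with (2 * PI * sqrt (INR (S n)) + - (PI * Im z * INR (S n)))
      by (unfold X; field; lra).
    rewrite exp_plus, <- !Rmult_assoc.
    apply Rmult_le_compat_r; [left; apply exp_pos|].
    rewrite Rmult_assoc. apply HN. lia.
  - apply Rmult_le_compat_l; [lra|]. now apply saddle_term_le. }
intros n. eapply Rle_trans; [apply HF|].
change (PI / Im z) with (PI * X).
apply Rplus_le_compat_l.
replace (eps * exp (PI * X)) with (eps / 50 * (exp (PI * X) * 50)) by field.
apply Rmult_le_compat_l; [lra|]. apply Rmult_le_compat_l; [lra|].
apply saddle_primitive_range.
Qed.

(** * Oscillation at the third cusp *)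

Lemma le_sin_PI_mult (t : R) : 0 <= t <= / 2 -> t <= sin (PI * t).
Proof.
intros Ht. pose proof PI2_3_2. pose proof PI_4. set (x := PI * t).
assert (Hx : 0 <= x <= 2) by (unfold x; nra).
destruct (SIN x) as [H1 _]; [lra | lra |].
apply Rle_trans with (2 := H1).
unfold sin_lb, sin_approx, sin_term; simpl.
assert (Hx2 : 0 <= x * x <= 4) by nra.
assert (t <= x / 3) by (unfold x; nra).
apply Rle_trans with (1 := H2).
assert (0 <= x * (2 / 3 - x * x / 6 + x * x * (x * x) * (/ 120 - x * x / 5040))); [|lra].
apply Rmult_le_pos; [lra|]. nra.
Qed.

Lemma harmonic_at_exp_sin (x y : R) :
  harmonic_at (fun x y => exp (PI * y) * sin (PI * x)) x y /\
  harmonic_at (fun x y => exp (- (PI * y)) * sin (PI * x)) x y.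
Proof.
split.
- apply harmonic_at_ext with
    (fun x y => Re (Ci * Cexp (- (Ci * PI) * (x, y)))).
  + intros u v. unfold Cexp, Ci, Cmult, Copp; simpl.
    replace ((- (0 * PI - 1 * 0) * u - - (0 * 0 + 1 * PI) * v)) with (PI * v) by ring.
    replace ((- (0 * PI - 1 * 0) * v + - (0 * 0 + 1 * PI) * u)) with (- (PI * u)) by ring.
    rewrite sin_neg. ring.
  + apply (peano2_harmonic_at (fun z => Re (Ci * Cexp (- (Ci * PI) * z)))), peano2_Cexp.
- apply harmonic_at_ext with
    (fun x y => Re (- Ci * Cexp (Ci * PI * (x, y)))).
  + intros u v. unfold Cexp, Ci, Cmult, Copp; simpl.
    replace ((0 * PI - 1 * 0) * u - (0 * 0 + 1 * PI) * v) with (- (PI * v)) by ring.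
    replace ((0 * PI - 1 * 0) * v + (0 * 0 + 1 * PI) * u) with (PI * u) by ring.
    ring.
  + apply (peano2_harmonic_at (fun z => Re (- Ci * Cexp (Ci * PI * z)))), peano2_Cexp.
Qed.

Lemma periodic2_bounded (U : R -> R -> R) (c d : R) :
  0 < c <= d -> periodic2 U -> (forall x y, c <= y <= d -> continuity_2d_pt U x y) ->
  exists K, 0 <= K /\ forall x y, c <= y <= d -> Rabs (U x y) <= K.
Proof.
intros Hcd HP HC.
destruct (rectangle_max (fun x y => Rabs (U x y)) (-1) 1 c d) as [p [q [_ [_ H]]]];
  try lra.
{ intros x y _ Hy. apply (continuity_1d_2d_pt_comp Rabs U); [apply Rcontinuity_abs|].
  now apply HC. }
exists (Rabs (U p q)). split; [apply Rabs_pos|]. intros x y Hy.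
destruct (reduce_mod2 (-1) x) as [n Hn].
rewrite <- (periodic2_IZR U n) by (exact HP || lra). apply H; lra.
Qed.

Definition odd_difference (U : R -> R -> R) (s x y : R) : R := U (s + x) y - U (s - x) y.

Lemma odd_difference_harmonic_at U s c x y :
  (forall x y, c < y -> harmonic_at U x y) -> c < y ->
  harmonic_at (odd_difference U s) x y.
Proof.
intros HU Hy. apply (harmonic_at_minus (fun x y => U (s + x) y) (fun x y => U (s - x) y)).
- apply harmonic_at_shift. now apply HU.
- apply harmonic_at_reflect. now apply HU.
Qed.

(** [s + 1] and [s - 1] differ by the period, so the odd part about [s] also vanishes at distance
    1. *)
Lemma odd_difference_edges U s y : periodic2 U -> 0 < y ->
  odd_difference U s 0 y = 0 /\ odd_difference U s 1 y = 0.
Proof.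
intros HP Hy. unfold odd_difference. split.
- rewrite Rplus_0_r, Rminus_0_r. ring.
- replace (s + 1) with (s - 1 + 2) by ring. rewrite HP by lra. ring.
Qed.

(** A barrier replaces a gradient estimate: [(y - c)^2 - x^2 + 2x] is harmonic, nonnegative on the
    vertical sides and at least 1 on the horizontal ones, yet at most [2 * t] at height [c]. The
    linear vanishing at the edges is what permits a comparison with [sin (PI * x)]. *)
Lemma odd_difference_le_linear (U : R -> R -> R) (c K : R) :
  periodic2 U -> (forall x y, 0 < y -> harmonic_at U x y) -> 1 < c -> 0 <= K ->
  (forall x y, c - 1 <= y <= c + 1 -> Rabs (U x y) <= K) ->
  forall s t, 0 <= t <= 1 -> Rabs (odd_difference U s t c) <= 4 * K * t.
Proof.
intros HP HU Hc HK HB s t Ht.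
assert (Main : forall sg, Rabs sg = 1 -> sg * odd_difference U s t c <= 4 * K * t).
{ intros sg Hsg.
  assert (B : sg * odd_difference U s t c - 2 * K * ((c - c) ^ 2 - t ^ 2 + 2 * t) <= 0).
  { apply (max_principle_rectangle (fun x y => sg * odd_difference U s x y -
      2 * K * ((y - c) ^ 2 - x ^ 2 + 2 * x)) 0 1 (c - 1) (c + 1)); try lra.
    - intros x y _ Hy. apply harmonic_at_minus; apply harmonic_at_scal.
      + apply odd_difference_harmonic_at with 0; [exact HU | lra].
      + apply harmonic_at_quadratic.
    - intros y Hy. destruct (odd_difference_edges U s y HP ltac:(lra)) as [-> ->].
      assert (0 <= K * (y - c) ^ 2) by (apply Rmult_le_pos; [lra | apply pow2_ge_0]).
      split; nra.
    - assert (D : forall x y, c - 1 <= y <= c + 1 -> sg * odd_difference U s x y <= 2 * K).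
      { intros x y Hy. eapply Rle_trans; [apply Rle_abs|].
        rewrite Rabs_mult, Hsg. unfold odd_difference.
        pose proof (HB (s + x) y Hy) as B1. pose proof (HB (s - x) y Hy) as B2.
        apply Rabs_le_between in B1. apply Rabs_le_between in B2.
        rewrite Rmult_1_l. apply Rabs_le_between. lra. }
      intros x Hx. pose proof (D x (c - 1) ltac:(lra)). pose proof (D x (c + 1) ltac:(lra)).
      replace ((c - 1 - c) ^ 2) with 1 by ring. replace ((c + 1 - c) ^ 2) with 1 by ring.
      assert (1 <= 1 - x ^ 2 + 2 * x) by nra. nra. }
  replace ((c - c) ^ 2) with 0 in B by ring. nra. }
apply Rabs_le_between. split.
- specialize (Main (-1)). rewrite Rabs_left in Main by lra. specialize (Main ltac:(ring)). lra.
- specialize (Main 1). rewrite Rabs_pos_eq in Main by lra. specialize (Main eq_refl). lra.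
Qed.

Lemma odd_difference_le_sin (U : R -> R -> R) (c K : R) :
  periodic2 U -> (forall x y, 0 < y -> harmonic_at U x y) -> 1 < c -> 0 <= K ->
  (forall x y, c - 1 <= y <= c + 1 -> Rabs (U x y) <= K) ->
  forall s t, 0 <= t <= 1 -> odd_difference U s t c <= 4 * K * sin (PI * t).
Proof.
intros HP HU Hc HK HB s t Ht.
destruct (Rle_or_lt t (/ 2)) as [Hl | Hl].
- eapply Rle_trans; [apply Rle_abs|].
  eapply Rle_trans; [apply odd_difference_le_linear with (K := K); assumption|].
  apply Rmult_le_compat_l; [lra|]. apply le_sin_PI_mult. lra.
(* By periodicity the odd part is also odd about the edge [t = 1], so this half of the strip reduces
   to the other. *)
- replace (odd_difference U s t c) with (- odd_difference U (s + 1) (1 - t) c).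
  + eapply Rle_trans; [apply Rle_abs|]. rewrite Rabs_Ropp.
    eapply Rle_trans; [apply odd_difference_le_linear with (K := K); try assumption; lra|].
    apply Rmult_le_compat_l; [lra|].
    replace (sin (PI * t)) with (sin (PI * (1 - t))).
    * apply le_sin_PI_mult. lra.
    * rewrite <- (sin_PI_x (PI * t)). f_equal. ring.
  + unfold odd_difference. replace (s + 1 + (1 - t)) with (s - t + 2) by ring.
    rewrite HP by lra. replace (s + 1 - (1 - t)) with (s + t) by ring. ring.
Qed.

(* The odd parts of [U] about vertical lines vanish on the sides of a strip of
   width 1, so growth below [exp (PI * y)] forces them to decay; periodicity
   then controls the whole oscillation of [U]. *)
Lemma bounded_oscillation (U : R -> R -> R) :
  periodic2 U -> (forall x y, 0 < y -> harmonic_at U x y) ->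
  (forall eta, 0 < eta -> exists V, forall x y, V <= y -> Rabs (U x y) <= eta * exp (PI * y)) ->
  exists K, forall x x' y, 2 <= y -> U x y - U x' y <= K.
Proof.
intros HP HU HG.
destruct (periodic2_bounded U 1 3) as [K [HK HB]]; [lra | exact HP | |].
{ intros x y Hy. apply HU. lra. }
exists (4 * K). intros x x' y Hy. pose proof PI_RGT_0 as HPI.
assert (Main : forall s t, 0 <= t <= 1 -> odd_difference U s t y <= 4 * K).
{ intros s t Ht. apply Rle_plus_epsilon. intros e He.
  set (eta := e * exp (- (PI * y))).
  assert (Heta : 0 < eta) by (apply Rmult_lt_0_compat; [exact He | apply exp_pos]).
  (* [odd_difference_le_sin] at height [v1] needs a bound up to height [v1 + 1] and multiplies it by
     4; both losses are compensated in advance. *)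
  destruct (HG (eta / 4 * exp (- PI))) as [V HV].
  { apply Rmult_lt_0_compat; [lra | apply exp_pos]. }
  set (v1 := Rmax (V + 1) y).
  assert (Hv1 : V + 1 <= v1 /\ y <= v1) by (split; [apply Rmax_l | apply Rmax_r]).
  assert (HS : forall x, 0 <= x <= 1 -> 0 <= sin (PI * x) <= 1).
  { intros z Hz. split; [apply sin_ge_0; nra | apply SIN_bound]. }
  (* Makes the decaying barrier equal to [4 * K * sin (PI * x)] on the bottom side [y = 2]. *)
  set (b := 4 * K * exp (PI * 2)).
  assert (B : odd_difference U s t y - (b * (exp (- (PI * y)) * sin (PI * t)) +
     eta * (exp (PI * y) * sin (PI * t))) <= 0).
  { apply (max_principle_rectangle (fun x y => odd_difference U s x y -
      (b * (exp (- (PI * y)) * sin (PI * x)) + eta * (exp (PI * y) * sin (PI * x))))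
      0 1 2 v1); try lra.
    - intros u v _ Hv. apply harmonic_at_minus; [|apply harmonic_at_plus].
      + apply odd_difference_harmonic_at with 0; [exact HU | lra].
      + apply harmonic_at_scal, harmonic_at_exp_sin.
      + apply harmonic_at_scal, harmonic_at_exp_sin.
    - intros v Hv. destruct (odd_difference_edges U s v HP ltac:(lra)) as [-> ->].
      rewrite Rmult_0_r, Rmult_1_r, sin_0, sin_PI. lra.
    - intros u Hu. specialize (HS u Hu). split.
      + assert (odd_difference U s u 2 <= 4 * K * sin (PI * u)).
        { apply odd_difference_le_sin; try assumption; try lra.
          intros; apply HB; lra. }
        replace (b * (exp (- (PI * 2)) * sin (PI * u))) with
          (4 * K * sin (PI * u) * (exp (PI * 2) * exp (- (PI * 2)))) by (unfold b; ring).
        rewrite <- exp_plus, Rplus_opp_r, exp_0.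
        assert (0 <= eta * (exp (PI * 2) * sin (PI * u))); [|lra].
        pose proof (exp_pos (PI * 2)). apply Rmult_le_pos; [lra|]. apply Rmult_le_pos; lra.
      + assert (odd_difference U s u v1 <=
          4 * (eta / 4 * exp (- PI) * exp (PI * (v1 + 1))) * sin (PI * u)).
        { apply odd_difference_le_sin; try assumption; try lra.
          - pose proof (exp_pos (- PI)). pose proof (exp_pos (PI * (v1 + 1))).
            apply Rmult_le_pos; [|lra]. apply Rmult_le_pos; lra.
          - intros p q Hq. eapply Rle_trans; [apply HV; lra|].
            apply Rmult_le_compat_l.
            { pose proof (exp_pos (- PI)). apply Rmult_le_pos; lra. }
            assert (PI * q <= PI * (v1 + 1)) as [L | ->]
              by (apply Rmult_le_compat_l; lra).
            + left; now apply exp_increasing.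
            + right; reflexivity. }
        replace (4 * (eta / 4 * exp (- PI) * exp (PI * (v1 + 1))) * sin (PI * u)) with
          (eta * (exp (PI * v1) * sin (PI * u))) in H.
        * assert (0 <= b * (exp (- (PI * v1)) * sin (PI * u))); [|lra].
          unfold b. pose proof (exp_pos (- (PI * v1))). pose proof (exp_pos (PI * 2)).
          apply Rmult_le_pos; apply Rmult_le_pos; lra.
        * replace (PI * v1) with (- PI + PI * (v1 + 1)) by ring. rewrite exp_plus. field. }
  specialize (HS t Ht).
  assert (E1 : b * (exp (- (PI * y)) * sin (PI * t)) <= 4 * K).
  { unfold b. replace (4 * K * exp (PI * 2) * (exp (- (PI * y)) * sin (PI * t))) with
      (4 * K * (exp (PI * 2) * exp (- (PI * y)) * sin (PI * t))) by ring.
    rewrite <- exp_plus. rewrite <- (Rmult_1_r (4 * K)) at 2.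
    apply Rmult_le_compat_l; [lra|].
    assert (exp (PI * 2 + - (PI * y)) <= 1).
    { rewrite <- exp_0. assert (PI * 2 + - (PI * y) <= 0) as [L | ->] by nra;
        [left; now apply exp_increasing | lra]. }
    pose proof (exp_pos (PI * 2 + - (PI * y))). nra. }
  assert (E2 : eta * (exp (PI * y) * sin (PI * t)) <= e).
  { unfold eta. replace (_ * _) with (e * (exp (- (PI * y)) * exp (PI * y)) * sin (PI * t)) by ring.
    rewrite <- exp_plus. replace (- (PI * y) + PI * y) with 0 by ring. rewrite exp_0. nra. }
  lra. }
(* A translate [w] of [x'] lies in [[x - 2, x]]; then [x] and [w] are mirror images about their
   midpoint, at distance at most 1 from it. *)
destruct (reduce_mod2 (x - 2) x') as [n Hn].
rewrite <- (periodic2_IZR U n x') by (exact HP || lra).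
set (w := x' + 2 * IZR n) in *.
specialize (Main ((x + w) / 2) ((x - w) / 2) ltac:(lra)). unfold odd_difference in Main.
replace ((x + w) / 2 + (x - w) / 2) with x in Main by field.
replace ((x + w) / 2 - (x - w) / 2) with w in Main by field. exact Main.
Qed.

(** The sign of [U] on the line [x = 0] decides: it is either eventually positive or nonpositive at
    arbitrarily large heights, and bounded oscillation spreads this one-sided bound to whole
    horizontal lines. *)
Lemma cusp_dichotomy (U : R -> R -> R) :
  periodic2 U -> (forall x y, 0 < y -> harmonic_at U x y) ->
  (forall eta, 0 < eta -> exists V, forall x y, V <= y -> Rabs (U x y) <= eta * exp (PI * y)) ->
  (exists L, forall N, exists v, N <= v /\ forall x, U x v <= L) \/
  (exists L, forall N, exists v, N <= v /\ forall x, - U x v <= L).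
Proof.
intros HP HU HG. destruct (bounded_oscillation U HP HU HG) as [K HK].
destruct (classic (exists N, forall v, N <= v -> 0 < U 0 v)) as [[N HN] | HN].
- right. exists K. intros N'. exists (Rmax 2 (Rmax N N')).
  pose proof (Rmax_l 2 (Rmax N N')). pose proof (Rmax_r 2 (Rmax N N')).
  pose proof (Rmax_l N N'). pose proof (Rmax_r N N').
  split; [lra|]. intros x. set (v := Rmax 2 (Rmax N N')) in *.
  specialize (HN v ltac:(lra)). specialize (HK 0 x v ltac:(lra)). lra.
- left. exists K. intros N'.
  destruct (not_all_ex_not _ _ (not_ex_all_not _ _ HN (Rmax 2 N'))) as [v Hv].
  apply imply_to_and in Hv. destruct Hv as [Hv1 Hv2].
  pose proof (Rmax_l 2 N'). pose proof (Rmax_r 2 N').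
  exists v. split; [lra|]. intros x. specialize (HK x 0 v ltac:(lra)). lra.
Qed.

(** * Reduction to a strip *)

Lemma Im_pos_neq_0 (z : C) : 0 < Im z -> z <> RtoC 0.
Proof. intros Hz ->. simpl in Hz. lra. Qed.

Lemma Re_neg_inv (x y : R) : Re (- / (x, y))%C = - x / (x ^ 2 + y ^ 2).
Proof. simpl. unfold Rdiv. ring. Qed.

Lemma Im_neg_inv (x y : R) : Im (- / (x, y))%C = y / (x ^ 2 + y ^ 2).
Proof. simpl. unfold Rdiv. ring. Qed.

Lemma Im_neg_inv_pos (z : C) : 0 < Im z -> 0 < Im (- / z)%C.
Proof.
destruct z as [x y]. intros Hz. rewrite Im_neg_inv. simpl in Hz.
apply Rdiv_lt_0_compat; nra.
Qed.

Lemma Im_plus_R (z : C) (r : R) : Im (z + r)%C = Im z.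
Proof. destruct z. simpl. ring. Qed.

(* [x -> x +- 2] and [tau -> tau / (1 -+ 2 tau)] generate the group; a point of
   small height outside the horoballs at the cusps [0] and [+-1] gains a fixed
   factor in height. *)
Lemma height_gain (x y : R) : 0 < y <= / 4 -> 0 <= x <= 1 ->
  y < x ^ 2 + y ^ 2 -> y < (x - 1) ^ 2 + y ^ 2 ->
  0 < 4 * (x ^ 2 + y ^ 2) - 4 * x + 1 <= 1 - 2 * y.
Proof.
intros Hy Hx H0 H1.
assert (Key : forall w, 0 <= w <= / 2 -> y < w ^ 2 + y ^ 2 -> y / 2 <= w - w ^ 2 - y ^ 2).
{ intros w Hw H. assert (3 / 2 * y <= w) by nra. nra. }
split.
{ replace (_ + 1) with ((1 - 2 * x) ^ 2 + 4 * y ^ 2) by ring.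
  pose proof (pow2_ge_0 (1 - 2 * x)). nra. }
destruct (Rle_or_lt x (/ 2)) as [Hl | Hl].
- specialize (Key x ltac:(lra) H0). lra.
- specialize (Key (1 - x) ltac:(lra)). replace ((1 - x) ^ 2) with ((x - 1) ^ 2) in Key by ring.
  specialize (Key H1). nra.
Qed.

(** [- V] is [U] in the coordinate at the cusp 0, so the period of [V] expresses the invariance of
    [U] under the parabolic maps fixing 0. *)
Record modular_pair (U V : C -> R) : Prop := {
  pair_left_periodic : forall z, 0 < Im z -> U (z + 2%R)%C = U z;
  pair_right_periodic : forall z, 0 < Im z -> V (z + 2%R)%C = V z;
  pair_inversion : forall z, 0 < Im z -> U z = - V (- / z)%C }.

Lemma periodic_minus_two (W : C -> R) :
  (forall z, 0 < Im z -> W (z + 2%R)%C = W z) ->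
  forall z, 0 < Im z -> W (z + (-2)%R)%C = W z.
Proof.
intros HW z Hz. rewrite <- HW by (rewrite Im_plus_R; exact Hz).
f_equal. rewrite <- Cplus_assoc, <- RtoC_plus. replace (-2 + 2) with 0 by ring.
apply Cplus_0_r.
Qed.

Lemma pair_inversion_sym U V z : modular_pair U V -> 0 < Im z -> - V z = U (- / z)%C.
Proof.
intros H Hz. rewrite (pair_inversion _ _ H) by now apply Im_neg_inv_pos.
do 2 f_equal. field. now apply Im_pos_neq_0.
Qed.

Lemma pair_parabolic_0 U V (z : C) (e : R) : modular_pair U V ->
  e = 1 \/ e = -1 -> 0 < Im z ->
  U (- / (- / z + (2 * e)%R))%C = U z.
Proof.
intros H He Hz. pose proof (Im_neg_inv_pos z Hz) as Hz'.
rewrite <- (pair_inversion_sym U V) by (exact H || rewrite Im_plus_R; exact Hz').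
destruct He as [-> | ->].
- rewrite Rmult_1_r, (pair_right_periodic _ _ H) by exact Hz'.
  symmetry. now apply (pair_inversion _ _ H).
- replace (2 * -1) with (-2) by ring.
  rewrite (periodic_minus_two V) by (exact (pair_right_periodic _ _ H) || exact Hz').
  symmetry. now apply (pair_inversion _ _ H).
Qed.

(** The parabolic map at the cusp 1 is a product of those at oo and 0: [s] is [1 - / z] translated
    by -2, and the map at 0 with [e = -1] takes it to [1 - / (z + 2)]. *)
Lemma pair_cusp1_periodic U V (z : C) : modular_pair U V -> 0 < Im z ->
  U (1%R - / (z + 2%R))%C = U (1%R - / z)%C.
Proof.
intros H Hz. pose proof (Im_neg_inv_pos z Hz) as Hz'.
set (s := (- / z + (-1)%R)%C).
assert (Hs : 0 < Im s) by (unfold s; rewrite Im_plus_R; exact Hz').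
assert (Nz : z <> RtoC 0) by now apply Im_pos_neq_0.
assert (Nz1 : (z + 1 <> 0)%C) by (apply Im_pos_neq_0; rewrite Im_plus_R; exact Hz).
assert (Nz2 : (z + 2 <> 0)%C) by (apply Im_pos_neq_0; rewrite Im_plus_R; exact Hz).
transitivity (U s).
- rewrite <- (pair_parabolic_0 U V s (-1)) by (exact H || exact Hs || now right).
  f_equal. unfold s. rewrite RtoC_mult. field. repeat split; try assumption.
  + intros E. apply Nz1. replace (z + 1)%C with (- ((-1)%R + (-1)%R * z))%C by ring.
    rewrite E. ring.
  + replace (- z + (-2)%R * ((-1)%R + (-1)%R * z))%C with (z + 2)%C by ring. exact Nz2.
- rewrite <- (pair_left_periodic _ _ H s) by exact Hs. f_equal.
  unfold s. ring.
Qed.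

(** The disc tangent to the real line at [e] is the half plane [1 <= Im z] in the coordinate
    [z = - / (tau - e)]; for [e = -1] the period 2 of [U] leads back to the cusp 1. *)
Lemma horoball_at_1 U V (x y e M : R) : modular_pair U V -> e = 1 \/ e = -1 -> 0 < y ->
  (forall z, 1 <= Im z -> U (1%R - / z)%C <= M) ->
  (x - e) ^ 2 + y ^ 2 <= y -> U (x, y) <= M.
Proof.
intros H He Hy HM Hh.
set (z := (- / ((x - e)%R, y))%C).
assert (Hxy : 0 < (x - e) ^ 2 + y ^ 2)
  by (pose proof (pow2_ge_0 (x - e)); pose proof (pow_lt y 2 Hy); lra).
assert (Hz : 1 <= Im z).
{ unfold z. rewrite Im_neg_inv. apply Rle_div_r; lra. }
specialize (HM z Hz).
replace (1%R - / z)%C with ((x - e + 1, y) : C) in HM.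
- destruct He as [-> | ->].
  + replace (x - 1 + 1) with x in HM by ring. exact HM.
  + rewrite <- (pair_left_periodic _ _ H) by exact Hy.
    replace ((x, y) + 2%R)%C with ((x - -1 + 1, y) : C); [exact HM|].
    unfold Cplus; simpl; f_equal; ring.
- unfold z. transitivity (((x - e)%R, y) + 1%R)%C.
  + unfold Cplus; simpl; f_equal; ring.
  + field. apply Im_pos_neq_0. exact Hy.
Qed.

(** [n] counts the reduction steps still allowed. Outside the horoballs a step divides the height by
    some [D <= 1 - 2 * y], so it gains at least the factor [1 + 2 * y0]; heights only increase, so
    [y0] remains a lower bound. *)
Lemma pair_reduction U V (M y0 : R) : modular_pair U V -> 0 < y0 ->
  (forall z, / 4 <= Im z -> U z <= M) ->
  (forall z, 1 <= Im z -> - V z <= M) ->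
  (forall z, 1 <= Im z -> U (1%R - / z)%C <= M) ->
  forall n x y, y0 <= y -> / 4 <= y * (1 + 2 * y0) ^ n -> U (x, y) <= M.
Proof.
intros H Hy0 Hinf H0 H1. induction n as [|n IH]; intros x y Hy Hn.
{ apply Hinf. simpl in Hn |- *. lra. }
destruct (Rle_or_lt (/ 4) y) as [Hl | Hl]; [now apply Hinf|].
assert (P2 : periodic2 (fun x y => U (x, y))).
{ intros u v Hv. rewrite <- (pair_left_periodic _ _ H (u, v)) by exact Hv.
  f_equal. unfold Cplus; simpl; f_equal; ring. }
destruct (reduce_mod2 (-1) x) as [k Hk].
rewrite <- (periodic2_IZR _ k x y P2) by lra.
set (w := x + 2 * IZR k) in *.
(* The sign [e] of [w] selects the nearer of the cusps 1 and -1 and the parabolic map that raises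
   the point. *)
assert (He : exists e, (e = 1 \/ e = -1) /\ 0 <= e * w <= 1 /\ e * e = 1).
{ destruct (Rle_or_lt 0 w); [exists 1 | exists (-1)]; repeat split; try lra; tauto. }
destruct He as [e [He [Hew Hee]]].
destruct (Rle_or_lt (w ^ 2 + y ^ 2) y) as [B0 | B0].
{ rewrite (pair_inversion _ _ H) by (simpl; lra). apply H0. rewrite Im_neg_inv.
  apply Rle_div_r; [nra | lra]. }
destruct (Rle_or_lt ((w - e) ^ 2 + y ^ 2) y) as [B1 | B1].
{ apply (horoball_at_1 U V w y e M); try assumption. lra. }
assert (G := height_gain (e * w) y ltac:(lra) Hew).
replace ((e * w) ^ 2) with (w ^ 2) in G by (rewrite Rpow_mult_distr; simpl; nra).
replace ((e * w - 1) ^ 2) with ((w - e) ^ 2) in G.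
2: { replace ((e * w - 1) ^ 2) with (e * e * w ^ 2 - 2 * (e * w) + 1) by ring.
     replace ((w - e) ^ 2) with (w ^ 2 - 2 * (e * w) + e * e) by ring. rewrite Hee. ring. }
specialize (G B0 B1). set (D := 4 * (w ^ 2 + y ^ 2) - 4 * (e * w) + 1) in *.
rewrite <- (pair_parabolic_0 U V (w, y) e) by (assumption || simpl; lra).
set (g := (- / (- / (w, y) + (2 * e)%R))%C).
assert (Hg : Im g = y / D).
{ unfold g. set (q := (- / (w, y) + (2 * e)%R)%C).
  rewrite (surjective_pairing q), Im_neg_inv.
  assert (Hq1 : fst q = - w / (w ^ 2 + y ^ 2) + 2 * e).
  { unfold q. rewrite <- Re_neg_inv. reflexivity. }
  assert (Hq2 : snd q = y / (w ^ 2 + y ^ 2)).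
  { unfold q. rewrite <- Im_neg_inv. apply Im_plus_R. }
  rewrite Hq1, Hq2.
  replace ((- w / (w ^ 2 + y ^ 2) + 2 * e) ^ 2 + (y / (w ^ 2 + y ^ 2)) ^ 2) with
    (D / (w ^ 2 + y ^ 2)).
  - field. lra.
  - transitivity ((4 * (e * e) * (w ^ 2 + y ^ 2) - 4 * (e * w) + 1) / (w ^ 2 + y ^ 2)).
    + unfold D. rewrite Hee, Rmult_1_r. reflexivity.
    + field. lra. }
assert (Hgain : y * (1 + 2 * y0) <= y / D).
{ apply -> Rle_div_r; [|lra]. rewrite Rmult_assoc.
  rewrite <- (Rmult_1_r y) at 2. apply Rmult_le_compat_l; [lra|]. nra. }
rewrite (surjective_pairing g). change (snd g) with (Im g). rewrite Hg.
apply IH; [nra|].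
eapply Rle_trans; [exact Hn|]. simpl. rewrite <- Rmult_assoc.
apply Rmult_le_compat_r; [apply pow_le; lra | exact Hgain].
Qed.

(** The candidate is the maximum over a compact rectangle. In each of the three cusp coordinates the
    line of height 1 is carried, up to periods, into the strip above that rectangle, so
    [cusp_max_principle] extends the bound to the cusp neighbourhoods and the reduction extends it
    to all other points. *)
Lemma pair_max_attained U V : modular_pair U V ->
  (forall z, 0 < Im z -> peano2 U z) -> (forall z, 0 < Im z -> peano2 V z) ->
  (exists L, forall z, 1 <= Im z -> Rabs (U z) <= L /\ Rabs (V z) <= L) ->
  (exists L, forall N, exists v, N <= v /\ forall x, U (1%R - / (x, v))%C <= L) ->
  exists p, / 4 <= Im p <= 1 /\ forall z, 0 < Im z -> U z <= U p.
Proof.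
intros H HU HV [L HL] Hcusp.
assert (PU : periodic2 (fun x y => U (x, y))).
{ intros u v Hv. rewrite <- (pair_left_periodic _ _ H (u, v)) by exact Hv.
  f_equal. unfold Cplus; simpl; f_equal; ring. }
assert (PV : periodic2 (fun x y => -1 * V (x, y))).
{ intros u v Hv. rewrite <- (pair_right_periodic _ _ H (u, v)) by exact Hv.
  do 2 f_equal. unfold Cplus; simpl; f_equal; ring. }
assert (PK : periodic2 (fun x y => U (1%R - / (x, y))%C)).
{ intros u v Hv. rewrite <- (pair_cusp1_periodic U V (u, v) H Hv).
  do 3 f_equal. unfold Cplus; simpl; f_equal; ring. }
destruct (rectangle_max (fun x y => U (x, y)) (-1) 1 (/ 4) 1) as [p [q [Hp [Hq HM]]]]; try lra.
{ intros x y _ Hy. apply peano2_harmonic_at, HU. simpl. lra. }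
set (M := U (p, q)) in HM.
assert (Strip : forall z, / 4 <= Im z <= 1 -> U z <= M).
{ intros [x y] Hy. simpl in Hy. destruct (reduce_mod2 (-1) x) as [n Hn].
  rewrite <- (periodic2_IZR _ n x y PU) by lra. apply HM; lra. }
exists (p, q). split; [exact Hq|]. fold M.
assert (Hinf : forall x y, 1 <= y -> U (x, y) <= M).
{ apply (cusp_max_principle (fun x y => U (x, y))); [lra | exact PU | | |].
  - intros x y Hy. apply peano2_harmonic_at, HU. simpl. lra.
  - intros x. apply Strip. simpl. lra.
  - exists L. intros N. exists (Rmax 1 N). split; [apply Rmax_r|].
    intros x. destruct (HL (x, Rmax 1 N)) as [B _]; [apply Rmax_l|].
    apply Rabs_le_between in B. lra. }
(* The height here is [1 / (x^2 + 1)], between 1/2 and 1. The cusp 0 uses [r = 0], the cusp 1 uses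
   [r = 1]. *)
assert (Horo : forall r x : R, -1 <= x <= 1 -> U (r%R - / (x, 1))%C <= M).
{ intros r x Hx. apply Strip.
  replace (r%R - / (x, 1))%C with (- / (x, 1) + r%R)%C by ring.
  rewrite Im_plus_R, Im_neg_inv. split.
  - apply Rle_div_r; nra.
  - apply Rle_div_l; nra. }
assert (H0 : forall x y, 1 <= y -> -1 * V (x, y) <= M).
{ apply (cusp_max_principle (fun x y => -1 * V (x, y))); [lra | exact PV | | |].
  - intros x y Hy. apply harmonic_at_scal, peano2_harmonic_at, HV. simpl. lra.
  - intros x. destruct (reduce_mod2 (-1) x) as [n Hn].
    rewrite <- (periodic2_IZR _ n x 1 PV) by lra.
    specialize (Horo 0 (x + 2 * IZR n) ltac:(lra)).
    replace (-1 * V (x + 2 * IZR n, 1)) with (- V (x + 2 * IZR n, 1)) by ring.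
    rewrite (pair_inversion_sym U V) by (exact H || simpl; lra).
    replace (- / ((x + 2 * IZR n)%R, 1))%C with (0%R - / ((x + 2 * IZR n)%R, 1))%C by ring.
    exact Horo.
  - exists L. intros N. exists (Rmax 1 N). split; [apply Rmax_r|].
    intros x. destruct (HL (x, Rmax 1 N)) as [_ B]; [apply Rmax_l|].
    apply Rabs_le_between in B. lra. }
assert (H1 : forall x y, 1 <= y -> U (1%R - / (x, y))%C <= M).
{ apply (cusp_max_principle (fun x y => U (1%R - / (x, y))%C)); [lra | exact PK | | | exact Hcusp].
  - intros x y Hy. apply (peano2_harmonic_at (fun z => U (1%R - / z)%C)).
    apply peano2_comp_inv; [apply Im_pos_neq_0; simpl; lra|]. apply HU.
    replace (1%R - / (x, y))%C with (- / (x, y) + 1%R)%C by ring.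
    rewrite Im_plus_R. apply Im_neg_inv_pos. simpl. lra.
  - intros x. destruct (reduce_mod2 (-1) x) as [n Hn].
    rewrite <- (periodic2_IZR _ n x 1 PK) by lra. apply Horo. lra. }
intros [x y] Hy. simpl in Hy.
destruct (Pow_x_infinity (1 + 2 * y)) with (b := / (4 * y)) as [n Hn].
{ rewrite Rabs_pos_eq; lra. }
apply (pair_reduction U V M y H Hy) with n.
- intros z Hz. destruct (Rle_or_lt (Im z) 1); [apply Strip; lra|].
  destruct z. apply Hinf. simpl in *. lra.
- intros [u v] Hz. specialize (H0 u v Hz). lra.
- intros [u v] Hz. now apply H1.
- lra.
- specialize (Hn n (le_n n)). rewrite Rabs_pos_eq in Hn by (apply pow_le; lra).
  apply Rge_le in Hn. replace (/ 4) with (y * / (4 * y)) by (field; lra).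
  apply Rmult_le_compat_l; lra.
Qed.

(** * Rigidity *)

Lemma re_qseries_periodic A z : re_qseries A (z + 2%R)%C = re_qseries A z.
Proof.
apply Series_ext. intros m. do 2 f_equal. unfold qexp.
replace (Ci * PI * INR m * (z + 2%R))%C with
  (Ci * PI * INR m * z + Ci * (2 * INR m * PI)%R)%C
  by (rewrite !RtoC_mult; ring).
rewrite Cexp_plus. rewrite <- (Cmult_1_r (Cexp (Ci * PI * INR m * z))) at 2.
f_equal. unfold Cexp, Ci, Cmult; simpl.
replace (0 * (2 * INR m * PI) - 1 * 0) with 0 by ring.
replace (0 * 0 + 1 * (2 * INR m * PI)) with (0 + 2 * INR m * PI) by ring.
rewrite cos_period, sin_period, exp_0, cos_0, sin_0. unfold RtoC. f_equal; ring.
Qed.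

Lemma re_qseries_tail A (m : nat) : abs_summable A ->
  exists K, 0 <= K /\ forall z, 1 <= Im z ->
    Rabs (re_qseries A z - sum_f_R0 (fun j => Re (A j * qexp j z)) m)
    <= K * exp (- (PI * INR (S m) * (Im z - 1))).
Proof.
intros HA. pose proof PI_RGT_0 as HPI.
set (b k := Cmod (A (S m + k)%nat) * exp (- (PI * INR (S m + k)))).
assert (Hb : ex_series b).
{ apply (ex_series_incr_n (fun k => Cmod (A k) * exp (- (PI * INR k))) (S m)).
  apply HA, HPI. }
assert (Hb0 : forall k, 0 <= b k).
{ intros k. apply Rmult_le_pos; [apply Cmod_ge_0 | left; apply exp_pos]. }
exists (Series b). split; [now apply Series_nonneg|].
intros z Hz. set (E := exp (- (PI * INR (S m) * (Im z - 1)))).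
assert (HE : 0 < E) by apply exp_pos.
unfold re_qseries. rewrite (Series_incr_n _ (S m)); [|lia | apply ex_series_qterm; [exact HA | lra]].
simpl Init.Nat.pred. rewrite Rplus_minus_l.
assert (Hk : forall k, Rabs (Re (A (S m + k)%nat * qexp (S m + k) z)) <= E * b k).
{ intros k. eapply Rle_trans; [apply Rabs_qterm_le|]. unfold b, E.
  replace (exp (- (PI * INR (S m) * (Im z - 1))) * _) with
    (Cmod (A (S m + k)%nat) * (exp (- (PI * INR (S m + k))) *
      exp (- (PI * INR (S m) * (Im z - 1))))) by ring.
  rewrite <- exp_plus.
  apply Rmult_le_compat_l; [apply Cmod_ge_0|].
  assert (L : - (PI * Im z * INR (S m + k)) <=
    - (PI * INR (S m + k)) + - (PI * INR (S m) * (Im z - 1))).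
  { rewrite plus_INR. pose proof (pos_INR k). pose proof (pos_INR (S m)).
    assert (0 <= PI * (INR k * (Im z - 1))) by (apply Rmult_le_pos; [lra|]; apply Rmult_le_pos; lra).
    lra. }
  destruct L as [L | ->]; [left; now apply exp_increasing | lra]. }
assert (HEb : ex_series (fun k => E * b k)).
{ now apply (ex_series_scal_l (K := R_AbsRing) (V := R_NormedModule)). }
rewrite Rmult_comm, <- Series_scal_l.
eapply Rle_trans; [apply Series_Rabs|].
- apply (ex_series_le (V := R_CompleteNormedModule)) with (fun k => E * b k); [|exact HEb].
  intros k. match goal with |- norm ?x <= _ => change (norm x) with (Rabs x) end.
  rewrite Rabs_Rabsolu. apply Hk.
- apply Series_le; [|exact HEb]. intros k. split; [apply Rabs_pos | apply Hk].
Qed.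

Lemma re_qterm_0 A z : Re (A 0%nat * qexp 0 z) = Re (A 0%nat).
Proof.
unfold qexp. simpl INR. destruct z as [x y], (A 0%nat) as [p q].
unfold Cexp, Ci, Cmult; simpl.
replace (((0 * PI - 1 * 0) * 0 - (0 * 0 + 1 * PI) * 0) * x -
  ((0 * PI - 1 * 0) * 0 + (0 * 0 + 1 * PI) * 0) * y) with 0 by ring.
replace (((0 * PI - 1 * 0) * 0 - (0 * 0 + 1 * PI) * 0) * y +
  ((0 * PI - 1 * 0) * 0 + (0 * 0 + 1 * PI) * 0) * x) with 0 by ring.
rewrite exp_0, cos_0, sin_0. ring.
Qed.

Lemma exp_decay (K c e : R) : 0 <= K -> 0 < c -> 0 < e ->
  exists t0, 0 <= t0 /\ forall t, t0 <= t -> K * exp (- (c * t)) <= e.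
Proof.
intros HK Hc He. exists (K / (c * e)).
assert (Hce : 0 < c * e) by now apply Rmult_lt_0_compat.
split; [now apply Rdiv_le_0_compat|]. intros t Ht.
apply Rle_div_l in Ht; [|exact Hce].
rewrite exp_Ropp. apply Rle_div_l; [apply exp_pos|].
pose proof (exp_ineq1_le (c * t)).
apply Rle_trans with (e * (1 + c * t)); [nra|]. apply Rmult_le_compat_l; lra.
Qed.

Lemma re_qseries_bounded A : abs_summable A ->
  exists L, forall z, 1 <= Im z -> Rabs (re_qseries A z) <= L.
Proof.
intros HA. destruct (re_qseries_tail A 0 HA) as [K [HK H]].
exists (K + Rabs (Re (A 0%nat))). intros z Hz. specialize (H z Hz).
cbn [sum_f_R0] in H. rewrite re_qterm_0 in H.
assert (K * exp (- (PI * INR 1 * (Im z - 1))) <= K).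
{ assert (E : exp (- (PI * INR 1 * (Im z - 1))) <= exp 0).
  { pose proof PI_RGT_0. apply exp_le_compat. simpl INR. nra. }
  rewrite exp_0 in E. nra. }
pose proof (Rabs_triang (re_qseries A z - Re (A 0%nat)) (Re (A 0%nat))) as T.
replace (re_qseries A z - Re (A 0%nat) + Re (A 0%nat)) with (re_qseries A z) in T by ring.
lra.
Qed.

Lemma re_qseries_limit A : abs_summable A -> forall e, 0 < e ->
  exists y0, 1 <= y0 /\ forall z, y0 <= Im z -> Rabs (re_qseries A z - Re (A 0%nat)) <= e.
Proof.
intros HA e He. destruct (re_qseries_tail A 0 HA) as [K [HK H]].
destruct (exp_decay K PI e HK PI_RGT_0 He) as [t [Ht0 Ht]].
exists (t + 1). split; [lra|]. intros z Hz.
assert (Hz1 : 1 <= Im z) by lra. specialize (H z Hz1).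
cbn [sum_f_R0] in H. rewrite re_qterm_0 in H. eapply Rle_trans; [exact H|].
simpl INR. rewrite Rmult_1_r. apply Ht. lra.
Qed.

Lemma sum_f_R0_ends (f : nat -> R) (m : nat) :
  (forall j, (0 < j <= m)%nat -> f j = 0) -> sum_f_R0 f (S m) = f 0%nat + f (S m).
Proof.
intros Hf. simpl. f_equal. induction m as [|m IH]; [reflexivity|].
simpl. rewrite IH by (intros; apply Hf; lia). rewrite (Hf (S m)) by lia. ring.
Qed.

Lemma qexp_polar (m : nat) (x y : R) :
  qexp m (x, y) = (exp (- (PI * INR m * y)) *
    (cos (PI * INR m * x), sin (PI * INR m * x)))%C.
Proof.
unfold qexp, Cexp, Ci, Cmult; simpl.
replace (((0 * PI - 1 * 0) * INR m - (0 * 0 + 1 * PI) * 0) * x -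
  ((0 * PI - 1 * 0) * 0 + (0 * 0 + 1 * PI) * INR m) * y) with (- (PI * INR m * y)) by ring.
replace (((0 * PI - 1 * 0) * INR m - (0 * 0 + 1 * PI) * 0) * y +
  ((0 * PI - 1 * 0) * 0 + (0 * 0 + 1 * PI) * INR m) * x) with (PI * INR m * x) by ring.
f_equal; ring.
Qed.

(* If the constant term is the supremum, the leading nonconstant term, whose
   phase is free, must vanish. *)
Lemma re_qseries_max_at_infinity A : abs_summable A ->
  (forall z, 0 < Im z -> re_qseries A z <= Re (A 0%nat)) ->
  forall m, (0 < m)%nat -> A m = RtoC 0.
Proof.
intros HA H m. pose proof PI_RGT_0 as HPI.
induction m as [m IH] using (well_founded_induction lt_wf). intros Hm.
destruct m as [|m]; [lia|].
assert (HM : 0 < INR (S m)) by (apply lt_0_INR; lia).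
destruct (re_qseries_tail A (S m) HA) as [K [HK HT]].
assert (Main : forall th, Re (A (S m) * (cos th, sin th))%C <= 0).
{ intros th. apply Rle_plus_epsilon. intros e He. rewrite Rplus_0_l.
  set (K' := K * exp (PI * INR (S m))).
  assert (HK' : 0 <= K') by (apply Rmult_le_pos; [exact HK | left; apply exp_pos]).
  destruct (exp_decay K' PI e HK' HPI He) as [t [Ht0 Ht]].
  (* The abscissa gives the leading term the phase [th]; the height makes the tail, relative to that
     term, at most [e]. *)
  set (z := ((th / (PI * INR (S m)), t + 1) : C)).
  specialize (HT z ltac:(simpl; lra)). specialize (H z ltac:(simpl; lra)).
  rewrite sum_f_R0_ends, re_qterm_0 in HT.
  2: { intros j Hj. rewrite IH by lia. rewrite Cmult_0_l. reflexivity. }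
  unfold z in HT. rewrite qexp_polar in HT. fold z in HT.
  replace (PI * INR (S m) * (th / (PI * INR (S m)))) with th in HT
    by (field; split; lra).
  set (E := exp (- (PI * INR (S m) * (t + 1)))) in HT.
  replace (A (S m) * (E * (cos th, sin th)))%C with
    (E * (A (S m) * (cos th, sin th)))%C in HT by ring.
  rewrite re_scal_l in HT. apply Rabs_le_between in HT.
  assert (HE : 0 < E) by apply exp_pos.
  apply Rmult_le_reg_l with E; [exact HE|].
  apply Rle_trans with (K * exp (- (PI * INR (S (S m)) * (Im z - 1)))); [lra|].
  specialize (Ht t (Rle_refl t)).
  apply Rle_trans with (E * (K' * exp (- (PI * t)))); [|apply Rmult_le_compat_l; lra].
  right. unfold K', E.
  replace (exp (- (PI * INR (S m) * (t + 1))) * (K * exp (PI * INR (S m)) * exp (- (PI * t))))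
    with (K * (exp (- (PI * INR (S m) * (t + 1))) * exp (PI * INR (S m)) * exp (- (PI * t)))) by ring.
  rewrite <- !exp_plus. do 2 f_equal. rewrite (S_INR (S m)). simpl Im. ring. }
(* The four axis directions bound the real and imaginary parts of the coefficient by 0 from both
   sides. *)
pose proof (Main 0) as M0. pose proof (Main (PI / 2)) as M1.
pose proof (Main PI) as M2. pose proof (Main (3 * (PI / 2))) as M3.
rewrite cos_0, sin_0 in M0. rewrite cos_PI2, sin_PI2 in M1.
rewrite cos_PI, sin_PI in M2. rewrite cos_3PI2, sin_3PI2 in M3.
destruct (A (S m)) as [p q]. simpl in M0, M1, M2, M3. unfold RtoC. f_equal; lra.
Qed.

(** If the maximum [M] exceeded [Re (A 0)] by [2 * d], the affine function equal to [M] at height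
    1/8 and to [M - d] at a large height [y0] would dominate the series in between, although it is
    below [M] at [p]. Any positive height under 1/4 could replace 1/8. *)
Lemma re_qseries_max_interior A p : abs_summable A -> / 4 <= Im p <= 1 ->
  (forall z, 0 < Im z -> re_qseries A z <= re_qseries A p) ->
  forall m, (0 < m)%nat -> A m = RtoC 0.
Proof.
intros HA Hp H. apply re_qseries_max_at_infinity; [exact HA|].
assert (Hle : re_qseries A p <= Re (A 0%nat)).
{ destruct (Rle_or_lt (re_qseries A p) (Re (A 0%nat))) as [L | L]; [exact L | exfalso].
  set (d := (re_qseries A p - Re (A 0%nat)) / 2). assert (Hd : 0 < d) by (unfold d; lra).
  destruct (re_qseries_limit A HA d Hd) as [y0 [Hy0 Hlim]].
  set (M := re_qseries A p) in *.
  set (s := d / (y0 - / 8)). assert (Hs : 0 < s) by (unfold s; apply Rdiv_lt_0_compat; lra).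
  assert (B : re_qseries A (fst p, snd p) - ((M - s * / 8 * -1) + - s * snd p) <= 0).
  { apply (max_principle_strip (fun x y => re_qseries A (x, y) -
      ((M - s * / 8 * -1) + - s * y)) (/ 8) y0); try lra.
    - intros x y Hy. f_equal. rewrite <- (re_qseries_periodic A (x, y)).
      f_equal. unfold Cplus; simpl; f_equal; ring.
    - intros x y Hy. apply harmonic_at_minus; [|apply harmonic_at_affine].
      apply (peano2_harmonic_at (re_qseries A)), peano2_re_qseries; [exact HA | simpl; lra].
    - intros x. split.
      + pose proof (H (x, / 8) ltac:(simpl; lra)). lra.
      + pose proof (Hlim (x, y0) ltac:(simpl; lra)) as B. apply Rabs_le_between in B.
        assert (s * (y0 - / 8) = d) by (unfold s; field; lra). unfold d in *. lra.
    - change (snd p) with (Im p). lra. }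
  rewrite <- surjective_pairing in B. fold M in B. change (snd p) with (Im p) in B. nra. }
intros z Hz. specialize (H z Hz). lra.
Qed.

Lemma abs_summable_opp A : abs_summable A -> abs_summable (fun m => - A m)%C.
Proof.
intros HA c Hc. eapply ex_series_ext; [|exact (HA c Hc)]. intros m. simpl.
now rewrite Cmod_opp.
Qed.

Lemma re_qseries_opp A z : re_qseries (fun m => - A m)%C z = - re_qseries A z.
Proof.
unfold re_qseries. rewrite <- Series_opp. apply Series_ext. intros m.
destruct (A m), (qexp m z). simpl. ring.
Qed.

Lemma pair_rigidity A B : abs_summable A -> abs_summable B ->
  (forall z, 0 < Im z -> re_qseries A z = - re_qseries B (- / z)%C) ->
  (exists L, forall N, exists v, N <= v /\
     forall x, re_qseries A (1%R - / (x, v))%C <= L) ->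
  forall m, (0 < m)%nat -> A m = RtoC 0.
Proof.
intros HA HB HAB HL.
destruct (pair_max_attained (re_qseries A) (re_qseries B)) as [p [Hp HM]].
- split; intros z Hz; [apply re_qseries_periodic | apply re_qseries_periodic | now apply HAB].
- intros. now apply peano2_re_qseries.
- intros. now apply peano2_re_qseries.
- destruct (re_qseries_bounded A HA) as [L1 H1]. destruct (re_qseries_bounded B HB) as [L2 H2].
  exists (Rmax L1 L2). intros z Hz. split.
  + eapply Rle_trans; [now apply H1 | apply Rmax_l].
  + eapply Rle_trans; [now apply H2 | apply Rmax_r].
- exact HL.
- now apply re_qseries_max_interior with p.
Qed.

(** With [tau = 1 - / (x, y)], [PI / Im tau = PI * y + PI * x^2 / y]. For [x] in one period and
    [y >= 1] the excess over [PI * y] is at most [PI], which the factor [exp (- PI)] absorbs. *)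
Lemma cusp1_growth A : abs_summable A ->
  (forall eps, 0 < eps -> exists N, forall m, (N <= m)%nat ->
     Cmod (A m) <= eps * (Rpower (INR m) (- (3 / 4)) * exp (2 * PI * sqrt (INR m)))) ->
  forall eta, 0 < eta -> exists V, forall x y, V <= y -> -1 <= x <= 1 ->
    Rabs (re_qseries A (1%R - / (x, y))%C) <= eta * exp (PI * y).
Proof.
intros HA HG eta Heta. pose proof PI_RGT_0 as HPI.
destruct (re_qseries_growth A HA HG (eta / 2 * exp (- PI))) as [K HK].
{ apply Rmult_lt_0_compat; [lra | apply exp_pos]. }
destruct (exp_decay (Rabs K) PI (eta / 2)) as [t [Ht0 Ht]]; [apply Rabs_pos | lra | lra |].
exists (Rmax 1 t). intros x y Hy Hx.
assert (Hy1 : 1 <= y) by (eapply Rle_trans; [apply Rmax_l | exact Hy]).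
assert (Hyt : t <= y) by (eapply Rle_trans; [apply Rmax_r | exact Hy]).
assert (HI : Im (1%R - / (x, y))%C = y / (x ^ 2 + y ^ 2)).
{ replace (1%R - / (x, y))%C with (- / (x, y) + 1%R)%C by ring.
  rewrite Im_plus_R. apply Im_neg_inv. }
assert (Hn : 0 < x ^ 2 + y ^ 2) by nra.
eapply Rle_trans; [apply HK|]; rewrite HI.
{ split; [apply Rdiv_lt_0_compat; lra|]. apply Rle_div_l; nra. }
specialize (Ht y Hyt).
assert (H1 : K <= eta / 2 * exp (PI * y)).
{ apply Rle_trans with (Rabs K); [apply Rle_abs|].
  replace (Rabs K) with (Rabs K * exp (- (PI * y)) * exp (PI * y)).
  - apply Rmult_le_compat_r; [left; apply exp_pos | exact Ht].
  - rewrite Rmult_assoc, <- exp_plus, Rplus_opp_l, exp_0. ring. }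
assert (H2 : exp (- PI) * exp (PI / (y / (x ^ 2 + y ^ 2))) <= exp (PI * y)).
{ rewrite <- exp_plus.
  assert (L : - PI + PI / (y / (x ^ 2 + y ^ 2)) <= PI * y).
  { replace (- PI + PI / (y / (x ^ 2 + y ^ 2))) with
      (PI * y + PI * ((x ^ 2 - y) / y)) by (field; lra).
    assert ((x ^ 2 - y) / y <= 0) by (apply Rle_div_l; nra). nra. }
  destruct L as [L | ->]; [left; now apply exp_increasing | lra]. }
rewrite Rmult_assoc. nra.
Qed.

Lemma real_uniqueness A B : abs_summable A -> abs_summable B ->
  B 0%nat = RtoC 0 ->
  (forall eps, 0 < eps -> exists N, forall m, (N <= m)%nat ->
     Cmod (A m) <= eps * (Rpower (INR m) (- (3 / 4)) * exp (2 * PI * sqrt (INR m)))) ->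
  (forall z, 0 < Im z -> re_qseries A z = - re_qseries B (- / z)%C) ->
  Re (A 0%nat) = 0 /\ forall m, (0 < m)%nat -> A m = RtoC 0 /\ B m = RtoC 0.
Proof.
intros HA HB HB0 HG HAB.
assert (Hpair : modular_pair (re_qseries A) (re_qseries B)).
{ split; intros z Hz; [apply re_qseries_periodic | apply re_qseries_periodic | now apply HAB]. }
set (k := fun x y => re_qseries A (1%R - / (x, y))%C).
assert (Hk2 : periodic2 k).
{ intros x y Hy. unfold k. rewrite <- (pair_cusp1_periodic _ _ (x, y) Hpair Hy).
  do 3 f_equal. unfold Cplus; simpl; f_equal; ring. }
assert (Hkh : forall x y, 0 < y -> harmonic_at k x y).
{ intros x y Hy. apply (peano2_harmonic_at (fun z => re_qseries A (1%R - / z)%C)).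
  apply peano2_comp_inv; [now apply Im_pos_neq_0|]. apply peano2_re_qseries; [exact HA|].
  replace (1%R - / (x, y))%C with (- / (x, y) + 1%R)%C by ring.
  rewrite Im_plus_R. now apply Im_neg_inv_pos. }
assert (HA0 : forall m, (0 < m)%nat -> A m = RtoC 0).
{ destruct (cusp_dichotomy k Hk2 Hkh) as [HL | [L HL]].
  - intros eta Heta. destruct (cusp1_growth A HA HG eta Heta) as [V HV].
    exists (Rmax V 1). intros x y Hy. pose proof (Rmax_l V 1). pose proof (Rmax_r V 1).
    destruct (reduce_mod2 (-1) x) as [n Hn].
    rewrite <- (periodic2_IZR k n x y Hk2) by lra. apply HV; lra.
  - now apply pair_rigidity with B.
  (* The other sign: the functional equation is linear, so both series may be negated. *)
  - intros m Hm.
    assert (E : (- A m)%C = RtoC 0).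
    { apply (pair_rigidity (fun m => - A m)%C (fun m => - B m)%C);
        try apply abs_summable_opp; try assumption.
      - intros z Hz. rewrite !re_qseries_opp, HAB by exact Hz. ring.
      - exists L. intros N. destruct (HL N) as [v [Hv Hv']]. exists v. split; [exact Hv|].
        intros x. rewrite re_qseries_opp. apply Hv'. }
    replace (A m) with (- (- A m))%C by ring. rewrite E. apply Copp_0. }
assert (HAc : forall z, 0 < Im z -> re_qseries A z = Re (A 0%nat)).
{ intros z Hz. unfold re_qseries.
  rewrite Series_incr_1 by now apply ex_series_qterm. rewrite re_qterm_0.
  rewrite (Series_ext _ (fun _ => 0 * 0)).
  - rewrite Series_scal_l. ring.
  - intros m. rewrite HA0 by lia. rewrite Cmult_0_l. simpl. ring. }
assert (HBc : forall z, 0 < Im z -> re_qseries B z = - Re (A 0%nat)).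
{ intros z Hz. rewrite <- (HAc (- / z)%C) by now apply Im_neg_inv_pos.
  rewrite <- (pair_inversion_sym _ _ z Hpair Hz). ring. }
assert (HRe : Re (A 0%nat) = 0).
{ apply Rle_antisym; apply Rle_plus_epsilon; intros e He;
    destruct (re_qseries_limit B HB e He) as [y [Hy H]];
    specialize (H (0, y) (Rle_refl y)); rewrite HBc, HB0 in H by (simpl; lra);
    apply Rabs_le_between in H; simpl in H; simpl; lra. }
split; [exact HRe|]. intros m Hm. split; [now apply HA0|].
apply re_qseries_max_at_infinity; [exact HB | | exact Hm].
intros z Hz. rewrite HBc, HB0 by exact Hz. simpl. simpl in HRe. lra.
Qed.

(** * Two-sided series *)

Lemma abs_summable_subexponential (A : nat -> C) :
  (forall eps, 0 < eps -> exists M N, forall m, (N <= m)%nat ->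
     Cmod (A m) <= M * exp (eps * INR m)) -> abs_summable A.
Proof.
intros H c Hc. destruct (H (c / 2)) as [M [N HN]]; [lra|].
apply (ex_series_incr_n (K := R_AbsRing) (V := R_NormedModule) _ N).
assert (Hq : exp (- (c / 2)) < 1) by (rewrite <- exp_0; apply exp_increasing; lra).
pose proof (exp_pos (- (c / 2))) as Hq0.
apply (ex_series_le (V := R_CompleteNormedModule)) with
  (fun k => Rabs M * exp (- (c / 2)) ^ k).
- intros k. match goal with |- norm ?x <= _ => change (norm x) with (Rabs x) end.
  pose proof (Cmod_ge_0 (A (N + k)%nat)). pose proof (exp_pos (- (c * INR (N + k)))).
  rewrite Rabs_pos_eq by (apply Rmult_le_pos; lra).
  apply Rle_trans with (M * exp (c / 2 * INR (N + k)) * exp (- (c * INR (N + k)))).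
  + apply Rmult_le_compat_r; [lra|]. apply HN. lia.
  + rewrite Rmult_assoc, <- exp_plus.
    apply Rle_trans with (Rabs M * exp (c / 2 * INR (N + k) + - (c * INR (N + k)))).
    * apply Rmult_le_compat_r; [left; apply exp_pos | apply Rle_abs].
    * apply Rmult_le_compat_l; [apply Rabs_pos|].
      rewrite <- Rpower_pow by exact Hq0. unfold Rpower. rewrite ln_exp.
      apply exp_le_compat. rewrite plus_INR. pose proof (pos_INR N). nra.
- apply (ex_series_scal_l (K := R_AbsRing) (V := R_NormedModule)).
  apply ex_series_geom. rewrite Rabs_pos_eq; lra.
Qed.

(* [Re (c * sum)] of a two-sided harmonic series as a one-sided series in [q],
   the terms of negative index being conjugated. *)
Definition folded (c c0 : C) (a : Z -> C) (m : nat) : C :=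
  match m with
  | O => c * c0
  | S _ => c * a (Z.of_nat m) + Cconj (c * a (- Z.of_nat m)%Z)
  end.

Lemma Cmod_folded_le c c0 a m : Cmod c = 1 -> (0 < m)%nat ->
  Cmod (folded c c0 a m) <= Cmod (a (Z.of_nat m)) + Cmod (a (- Z.of_nat m)%Z).
Proof.
intros Hc Hm. destruct m as [|m]; [lia|]. unfold folded.
eapply Rle_trans; [apply Cmod_triangle|].
rewrite Cmod_conj, !Cmod_mult, Hc. lra.
Qed.

Lemma Rabs_IZR_of_nat (m : nat) :
  Rabs (IZR (Z.of_nat m)) = INR m /\ Rabs (IZR (- Z.of_nat m)) = INR m.
Proof.
rewrite opp_IZR, Rabs_Ropp, <- INR_IZR_INZ, Rabs_pos_eq by apply pos_INR.
split; reflexivity.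
Qed.

Lemma folded_abs_summable c c0 a : Cmod c = 1 -> subexponential a ->
  abs_summable (folded c c0 a).
Proof.
intros Hc Ha. apply abs_summable_subexponential. intros e He.
destruct (Ha e He) as [M [N HN]]. exists (2 * M), (S (Z.to_nat N)). intros m Hm.
eapply Rle_trans; [apply Cmod_folded_le; [exact Hc | lia]|].
destruct (Rabs_IZR_of_nat m) as [E1 E2].
pose proof (HN (Z.of_nat m) ltac:(lia)) as H1.
pose proof (HN (- Z.of_nat m)%Z ltac:(lia)) as H2.
cbv beta in H1, H2. rewrite E1 in H1. rewrite E2 in H2. lra.
Qed.

Lemma Cconj_Cexp z : Cconj (Cexp z) = Cexp (Cconj z).
Proof.
destruct z as [x y]. unfold Cexp, Cconj; simpl. rewrite cos_neg, sin_neg.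
f_equal. ring.
Qed.

Lemma Re_conj_mult u v : Re (u * Cconj v) = Re (Cconj u * v).
Proof. destruct u, v. simpl. ring. Qed.

(** The exponentials of index [- n] at [Cconj z] are the conjugates of those of index [n] at [z]; a
    real part allows the conjugation to be moved to the coefficient. *)
Lemma Re_hfs_terms a b c k z : 0 < Im z ->
  Re (c * hfs_term a b (Z.of_nat (S k)) z) +
  Re (c * hfs_term a b (- Z.of_nat (S k)) (Cconj z)) =
  Re (folded c (a 0%Z) a (S k) * qexp (S k) z) +
  Re (folded c 0 b (S k) * qexp (S k) (- / z)).
Proof.
intros Hz. assert (Nz := Im_pos_neq_0 z Hz).
unfold folded, hfs_term. set (n := Z.of_nat (S k)).
assert (En : IZR n = INR (S k)) by (unfold n; now rewrite <- INR_IZR_INZ).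
assert (E1 : Cexp (Ci * PI * IZR n * z) = qexp (S k) z) by (unfold qexp; now rewrite En).
assert (E2 : Cexp (- (Ci * PI * IZR n) / z) = qexp (S k) (- / z)).
{ unfold qexp. rewrite En. f_equal. unfold Cdiv. ring. }
assert (Ec : forall w, Cconj (Ci * PI * INR (S k) * w) = (- (Ci * PI * INR (S k) * Cconj w))%C).
{ intros [x y]. unfold Cconj, Ci, Cmult, Copp, RtoC. cbn [fst snd]. f_equal; ring. }
assert (E3 : Cexp (Ci * PI * IZR (- n) * Cconj z) = Cconj (qexp (S k) z)).
{ unfold qexp. rewrite Cconj_Cexp, Ec, opp_IZR, En, RtoC_opp. f_equal. ring. }
assert (E4 : Cexp (- (Ci * PI * IZR (- n)) / Cconj z) = Cconj (qexp (S k) (- / z))).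
{ unfold qexp. rewrite Cconj_Cexp, Ec, opp_IZR, En, RtoC_opp, Copp_conj, Cinv_conj by exact Nz.
  f_equal. unfold Cdiv. ring. }
rewrite E1, E2, E3, E4, !Cmult_plus_distr_l, !Cmult_plus_distr_r, !re_plus, !Cmult_assoc.
rewrite (Re_conj_mult (c * a (- n)%Z)), (Re_conj_mult (c * b (- n)%Z)). ring.
Qed.

(** The given series sums the [a] and [b] terms jointly; subexponential growth makes each part
    converge separately, so it may be split. The constant [a 0] is assigned to the first part, hence
    the constant term 0 of the second. *)
Lemma folded_functional_equation a b c : Cmod c = 1 ->
  subexponential a -> subexponential b ->
  (forall tau : C, 0 < Im tau -> is_harmonic_hfs a b tau (RtoC 0)) ->
  forall z, 0 < Im z ->
    re_qseries (folded c (a 0%Z) a) z = - re_qseries (folded c 0 b) (- / z)%C.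
Proof.
intros Hc Ha Hb Hzero z Hz.
destruct (Hzero z Hz) as [sp [sm [Hp [Hm E]]]].
apply (is_series_scal (K := C_AbsRing) (V := C_NormedModule) c) in Hp.
apply (is_series_scal (K := C_AbsRing) (V := C_NormedModule) c) in Hm.
apply is_series_Re in Hp. apply is_series_Re in Hm.
pose proof (is_series_plus (V := R_NormedModule) _ _ _ _ Hp Hm) as H.
assert (H' : is_series (fun k => Re (folded c (a 0%Z) a (S k) * qexp (S k) z) +
  Re (folded c 0 b (S k) * qexp (S k) (- / z))) (Re (c * sp) + Re (c * sm))).
{ eapply is_series_ext; [|exact H]. intros k. now apply Re_hfs_terms. }
apply is_series_unique in H'.
assert (SA := folded_abs_summable c (a 0%Z) a Hc Ha).
assert (SB := folded_abs_summable c 0 b Hc Hb).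
assert (XA := ex_series_qterm _ z SA Hz).
assert (XB := ex_series_qterm _ _ SB (Im_neg_inv_pos z Hz)).
rewrite Series_plus in H'.
2: { exact (proj1 (ex_series_incr_1 (V := R_NormedModule) _) XA). }
2: { exact (proj1 (ex_series_incr_1 (V := R_NormedModule) _) XB). }
unfold re_qseries.
rewrite (Series_incr_1 _ XA), (Series_incr_1 _ XB), !re_qterm_0.
assert (E' : Re (c * (a 0%Z + sp + sm)) = 0) by (rewrite E, Cmult_0_r; reflexivity).
rewrite !Cmult_plus_distr_l, !re_plus in E'.
unfold folded at 1 3. rewrite Cmult_0_r. simpl (Re 0). lra.
Qed.

Theorem theorem3p6p6 (a b : Z -> C)
  (ha : subexponential a) (hb : subexponential b)
  (hzero : forall tau : C, 0 < Im tau -> is_harmonic_hfs a b tau (RtoC 0))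
  (hgrowth : is_domin (U := R_NormedModule) (V := C_NormedModule) Z_infty
     (fun n : Z => Rpower (Rabs (IZR n)) (- (3 / 4))
                   * exp (2 * PI * sqrt (Rabs (IZR n))))
     a) :
  a 0%Z = RtoC 0 /\
  forall n : Z, n <> 0%Z -> a n = RtoC 0 /\ b n = RtoC 0.
Proof.
assert (Main : forall c, Cmod c = 1 -> Re (c * a 0%Z) = 0 /\
  forall m, (0 < m)%nat -> folded c (a 0%Z) a m = RtoC 0 /\ folded c 0 b m = RtoC 0).
{ intros c Hc.
  apply (real_uniqueness (folded c (a 0%Z) a) (folded c 0 b)).
  - now apply folded_abs_summable.
  - now apply folded_abs_summable.
  - apply Cmult_0_r.
  - intros e He. assert (He2 : 0 < e / 2) by lra.
    (* Half of [e] for each of the two coefficients folded together; the successor keeps [m] away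
       from the constant term. *)
    destruct (hgrowth (mkposreal _ He2)) as [N HN]. exists (S (Z.to_nat N)). intros m Hm.
    eapply Rle_trans; [apply Cmod_folded_le; [exact Hc | lia]|].
    destruct (Rabs_IZR_of_nat m) as [E1 E2].
    pose proof (HN (Z.of_nat m) ltac:(lia)) as H1.
    pose proof (HN (- Z.of_nat m)%Z ltac:(lia)) as H2.
    cbv beta in H1, H2. rewrite E1 in H1. rewrite E2 in H2.
    set (g := Rpower (INR m) (- (3 / 4)) * exp (2 * PI * sqrt (INR m))) in *.
    assert (Hg : 0 < g) by (apply Rmult_lt_0_compat; apply exp_pos).
    change (Cmod (a (Z.of_nat m)) <= e / 2 * Rabs g) in H1.
    change (Cmod (a (- Z.of_nat m)%Z) <= e / 2 * Rabs g) in H2.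
    rewrite Rabs_pos_eq in H1, H2 by lra. lra.
  - now apply folded_functional_equation. }
destruct (Main 1 Cmod_1) as [R1 H1].
destruct (Main (- Ci)%C) as [R2 H2]; [rewrite Cmod_opp; apply Cmod_Ci|].
(* The choice [c = 1] gives [u = - Cconj v] and [c = -i] gives [u = Cconj v], which separates the
   indices [n] and [- n]. *)
assert (Key : forall u v : C, (1 * u + Cconj (1 * v) = 0)%C ->
  (- Ci * u + Cconj (- Ci * v) = 0)%C -> u = RtoC 0 /\ v = RtoC 0).
{ intros [u1 u2] [v1 v2] E1 E2. apply (f_equal Re) in E1 as E1r. apply (f_equal Im) in E1.
  apply (f_equal Re) in E2 as E2r. apply (f_equal Im) in E2.
  simpl in *. unfold RtoC. split; f_equal; lra. }
split.
{ destruct (a 0%Z) as [x y]. simpl in R1, R2. unfold RtoC. f_equal; lra. }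
assert (Pos : forall m, (0 < m)%nat ->
  (a (Z.of_nat m) = RtoC 0 /\ a (- Z.of_nat m)%Z = RtoC 0) /\
  (b (Z.of_nat m) = RtoC 0 /\ b (- Z.of_nat m)%Z = RtoC 0)).
{ intros m Hm. destruct (H1 m Hm) as [A1 B1]. destruct (H2 m Hm) as [A2 B2].
  destruct m as [|m]; [lia|]. split; apply Key; assumption. }
intros n Hn. destruct (Pos (Z.to_nat (Z.abs n)) ltac:(lia)) as [[A1 A2] [B1 B2]].
rewrite Z2Nat.id in A1, A2, B1, B2 by lia.
destruct (Z_lt_le_dec 0 n).
- rewrite Z.abs_eq in A1, B1 by lia. split; assumption.
- rewrite Z.abs_neq, Z.opp_involutive in A2, B2 by lia. split; assumption.
Qed.
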